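(* Let $N\ge 0$, and let $\bm v$ be a smooth center, $C^0,\bm C^1,\dots,\bm C^N$ smooth fields of symmetric tensors on $\Omega_x\times(0,T)$ ($\bm C^a$ of rank $a$), and $g_N$ the associated ansatz of degree $N$, $$g_N=\sum_{a=0}^N\frac{(-1)^a}{a!}\sum_{i_1,\dots,i_a=1}^d C^a_{i_1\dots i_a}(\bm x,t)\,\partial_{u_{i_1}}\cdots\partial_{u_{i_a}}\delta(\bm u-\bm v(\bm x,t)).$$ Let $\bm G,\bm F\in C^\infty(\Omega)^d$ and $R\in C^\infty(\Omega)$ be coefficients satisfying the coupling system $\bm{\mathcal A}[\bm G,\bm F,R,g_N]=0$. Suppose that: (i) the moments satisfy the centered moment hierarchy of degree $N$ closed with $g_N$: for every $k=0,\dots,N$, $$\partial_t \bm C^k=\int_{\Omega_u} g_N\,\partial_t\big[(\bm u-\bm v)^{\otimes k}\big]du-\int_{\Omega_u}\nabla\cdot(\bm G(\bm u)g_N)(\bm u-\bm v)^{\otimes k}du-\int_{\Omega_u}\nabla_u\cdot(\bm F(\bm u)g_N)(\bm u-\bm v)^{\otimes k}du-\int_{\Omega_u}R(\bm u)\,g_N(\bm u-\bm v)^{\otimes k}du;$$ (ii) the center satisfies $\partial_t\bm v=-\bm G(\bm v)\cdot(\nabla\bm v)+\bm F(\bm v)$, i.e. $\partial_t v_j=-\sum_{i=1}^d G_i(\bm v(\bm x,t),\bm x,t)\,\partial_{x_i}v_j+F_j(\bm v(\bm x,t),\bm x,t)$ for $j=1,\dots,d$. Then $g_N$ is an exact (distributional)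 solution of the conservation law: for all $\phi\in C_0^\infty(\Omega)$, $$\int_\Omega\partial_t g_N\,\phi\,dV+\int_\Omega\nabla\cdot(\bm G g_N)\,\phi\,dV+\int_\Omega\nabla_u\cdot(\bm F g_N)\,\phi\,dV+\int_\Omega R\,g_N\,\phi\,dV=0 .$$
   Context: Setting: $d\ge1$, $\Omega_u,\Omega_x\subset\mathbb R^d$ are open, $T>0$, $\Omega=\Omega_u\times\Omega_x\times(0,T)$ with coordinates $(\bm u,\bm x,t)$ (momentum, position, time), $dV=dt\,dx\,du$. $\nabla$ and $\nabla_u$ are the gradients in $\bm x$ and $\bm u$; $C_0^\infty(\Omega)$ denotes smooth functions with compact support. The center is $\bm v\in C^\infty(\Omega_x\times[0,T])^d$ with values in $\Omega_u$. The arguments $(\bm x,t)$ of coefficients are suppressed: $\bm G(\bm u)=\bm G(\bm u,\bm x,t)$, $\bm G(\bm v)=\bm G(\bm v(\bm x,t),\bm x,t)$. The conservation law is $\partial_t g+\nabla\cdot(\bm G g)+\nabla_u\cdot(\bm F g)+Rg=0$. The coefficients may depend on the unknown $g$; this dependence is encoded by an arbitrary system of differential-algebraic equations $\bm{\mathcal A}[\bm G,\bm F,R,g]=0$ (for example Maxwell's equations), about which nothing is assumed except that it relates the smooth coefficients to $g_N$. Distributions: $\delta(\bm u-\bm v)$ is the distribution on $\Omega$ given by $\int_\Omega\delta(\bm u-\bm v)\phi\,dV=\int\int\phi(\bm v(\bm x,t),\bm x,t)\,dx\,dt$; all derivatives of $g_N$ on $\Omega$ are distributional. They obey the product rule and the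 chain rule $\nabla\delta(\bm u-\bm v)=-\nabla\bm v\cdot\nabla_u\delta(\bm u-\bm v)$ (with $(\nabla\bm v)_{ij}=\partial_i v_j$), $\partial_t\delta(\bm u-\bm v)=-\partial_t\bm v\cdot\nabla_u\delta(\bm u-\bm v)$; thus, for each $(\bm x,t)$, $g_N$ and its $\bm x$-, $t$-, $\bm u$-derivatives are finite combinations of $\bm u$-derivatives of the Dirac mass at $\bm v(\bm x,t)$, and integrals over $\Omega_u$ denote the pairing of such a distribution in $\bm u$ with a smooth function of $\bm u$. Here $\bm w^{\otimes k}$ is the $k$-fold outer product ($\bm w^{\otimes 0}=1$, so the first integral in (i) is $0$ for $k=0$), and in (i) the tensor identity is meant componentwise. *)

(* Defs.v *)
From HB Require Import structures.
From mathcomp Require Import all_boot all_order all_algebra.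
From mathcomp Require Import all_classical all_reals all_analysis.
Set Implicit Arguments.
Unset Strict Implicit.
Unset Printing Implicit Defensive.
Import Order.TTheory GRing.Theory Num.Theory.
Import numFieldNormedType.Exports.
Local Open Scope classical_set_scope.
Local Open Scope ring_scope.

Section Smooth.
Variables (R : realType) (V W : normedModType R).
Implicit Types (f : V -> W) (D : set V).

Definition iter_derive (ws : seq V) f : V -> W :=
  foldr (fun w g => fun p => 'D_w g p) f ws.

(* C^oo on an open set: every iterated directional derivative exists and is
   Frechet differentiable (hence continuous) at every point of [D].  Values of
   [f] outside [D] are irrelevant. *)
Definition smooth D f : Prop :=
  forall ws p, D p -> differentiable (iter_derive ws f) p.

(* C^oo up to the part of the boundary contained in [E], for [D `<=` E] open
   and dense in [E]: [f] is continuous on [E], smooth on [D], and all its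
   iterated derivatives on [D] extend continuously to [E]. *)
Definition smooth_upto D E f : Prop :=
  [/\ smooth D f, {within E, continuous f} &
      forall ws, exists2 g : V -> W, {within E, continuous g} &
        forall p, D p -> iter_derive ws f p = g p].

End Smooth.

Definition test_function (R : realType) (V : normedModType R) (D : set V)
    (phi : V -> R) : Prop :=
  smooth D phi /\
  exists K : set V, [/\ compact K, K `<=` D & forall p, ~ K p -> phi p = 0].

(* Lebesgue integral over R^n as an iterated one-dimensional integral.  It is
   only applied to continuous integrands with compact support, for which it
   agrees with the integral against the n-fold product measure (Fubini). *)
Fixpoint rV_integral (R : realType) (n : nat) : ('rV[R]_n -> R) -> R :=
  match n return ('rV[R]_n -> R) -> R with
  | 0%N => fun f => f 0
  | m.+1 => fun f => \int[@lebesgue_measure R]_s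
      rV_integral (fun x : 'rV[R]_m => f (row_mx (s%:M : 'rV[R]_1) x))
  end.

(* Points (x, t), and points (u, (x, t)). *)
Notation spacetime_of R d := ('rV[R]_d * R)%type.
Notation phase_of R d := ('rV[R]_d * ('rV[R]_d * R))%type.

Section KineticEquation.
Variables (R : realType) (d : nat).

Notation vec := 'rV[R]_d.
Notation spacetime := (spacetime_of R d).
Notation phase := (phase_of R d).

Definition spacetime_dom (Omx : set vec) (T : R) : set spacetime :=
  Omx `*` [set t | 0 < t < T].
Definition spacetime_cl (Omx : set vec) (T : R) : set spacetime :=
  Omx `*` [set t | 0 <= t <= T].
Definition phase_dom (Omu Omx : set vec) (T : R) : set phase :=
  Omu `*` spacetime_dom Omx T.

Definition e_ (i : 'I_d) : vec := delta_mx 0 i.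
Definition dir_x (i : 'I_d) : spacetime := (e_ i, 0).
Definition dir_t : spacetime := (0, 1).

Definition spacetime_integral (D : set spacetime) (f : spacetime -> R) : R :=
  \int[@lebesgue_measure R]_t rV_integral (fun x : vec => (f \_ D) (x, t)).

(* Distributions as functionals; only their values on test functions matter. *)
Definition phase_distr := (phase -> R) -> R.

Definition dist_derive (w : phase) (S : phase_distr) : phase_distr :=
  fun phi => - S (fun p => 'D_w phi p).
Definition dist_mul (f : phase -> R) (S : phase_distr) : phase_distr :=
  fun phi => S (fun p => f p * phi p).

Definition dist_dt := dist_derive (0, dir_t).
Definition dist_dx (i : 'I_d) := dist_derive (0, dir_x i).
Definition dist_du (i : 'I_d) := dist_derive (e_ i, 0).

Definition dist_div_x (G : phase -> vec) (S : phase_distr) : phase_distr :=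
  fun phi => \sum_(i < d) dist_dx i (dist_mul (fun p => G p 0 i) S) phi.
Definition dist_div_u (F : phase -> vec) (S : phase_distr) : phase_distr :=
  fun phi => \sum_(i < d) dist_du i (dist_mul (fun p => F p 0 i) S) phi.

(* delta(u - v), for a center [v] defined on the space-time domain [D] *)
Definition dist_delta (D : set spacetime) (v : spacetime -> vec) :
  phase_distr := fun phi => spacetime_integral D (fun q => phi (v q, q)).

(* [C a i] is the component (i_1, ..., i_a) of the rank-[a] tensor C^a. *)
Definition tensor_fields := forall a : nat, a.-tuple 'I_d -> spacetime -> R.

Definition ansatz (D : set spacetime) (N : nat) (v : spacetime -> vec)
    (C : tensor_fields) : phase_distr :=
  fun phi => \sum_(a < N.+1) ((-1) ^+ a / a`!%:R *
    \sum_(i : a.-tuple 'I_d)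
      dist_mul (fun p => C a i p.2) (foldr dist_du (dist_delta D v) i) phi).

(* A distribution supported on the graph of the center is, at each fixed
   (x, t), a distribution in u; a [fibred] is the family of these.  The
   integral over Omega_u of S against psi at (x, t) is [S (x, t) psi]. *)
Definition fibred := spacetime -> (vec -> R) -> R.

(* The (x, t)-derivative of a family of distributions in u is the derivative
   of its pairing with a test function that does not depend on (x, t); this
   gives the product rule and the chain rule ([fib_derive_delta]). *)
Definition fib_derive (w : spacetime) (S : fibred) : fibred :=
  fun q psi => 'D_w (fun r => S r psi) q.
Definition fib_du (i : 'I_d) (S : fibred) : fibred :=
  fun q psi => - S q (fun u => 'D_(e_ i) psi u).
Definition fib_mul (f : phase -> R) (S : fibred) : fibred :=
  fun q psi => S q (fun u => f (u, q) * psi u).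

Definition fib_div_x (G : phase -> vec) (S : fibred) : fibred :=
  fun q psi =>
    \sum_(i < d) fib_derive (dir_x i) (fib_mul (fun p => G p 0 i) S) q psi.
Definition fib_div_u (F : phase -> vec) (S : fibred) : fibred :=
  fun q psi => \sum_(i < d) fib_du i (fib_mul (fun p => F p 0 i) S) q psi.

Definition fib_delta (v : spacetime -> vec) : fibred := fun q psi => psi (v q).

Definition fib_ansatz (N : nat) (v : spacetime -> vec) (C : tensor_fields) :
  fibred :=
  fun q psi => \sum_(a < N.+1) ((-1) ^+ a / a`!%:R *
    \sum_(i : a.-tuple 'I_d)
      fib_mul (fun p => C a i p.2) (foldr fib_du (fib_delta v) i) q psi).

(* component (j_1, ..., j_k) of (u - v)^{\otimes k} *)
Definition centered_power (v : spacetime -> vec) (k : nat) (j : k.-tuple 'I_d)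
    (q : spacetime) (u : vec) : R :=
  \prod_(l < k) (u - v q) 0 (tnth j l).

Definition symmetric_on (D : set spacetime) (a : nat)
    (Ca : a.-tuple 'I_d -> spacetime -> R) : Prop :=
  forall i j : a.-tuple 'I_d, perm_eq i j ->
    forall q, D q -> Ca i q = Ca j q.

Definition moment_hierarchy (D : set spacetime) (N : nat)
    (v : spacetime -> vec) (C : tensor_fields)
    (G F : phase -> vec) (Rc : phase -> R) : Prop :=
  let g := fib_ansatz N v C in
  forall (k : nat), (k <= N)%N -> forall (j : k.-tuple 'I_d) q, D q ->
  'D_dir_t (C k j) q =
      g q (fun u => 'D_dir_t (fun r => centered_power v j r u) q)
    - fib_div_x G g q (centered_power v j q)
    - fib_div_u F g q (centered_power v j q)
    - fib_mul Rc g q (centered_power v j q).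

Definition center_equation (D : set spacetime) (v : spacetime -> vec)
    (G F : phase -> vec) : Prop :=
  forall q, D q -> forall j : 'I_d,
  'D_dir_t v q 0 j =
    - (\sum_(i < d) G (v q, q) 0 i * 'D_(dir_x i) v q 0 j) + F (v q, q) 0 j.

Lemma fib_derive_delta (v : spacetime -> vec) (w q : spacetime)
    (psi : vec -> R) :
  differentiable v q -> differentiable psi (v q) ->
  fib_derive w (fib_delta v) q psi =
    - \sum_(j < d) 'D_w v q 0 j * fib_du j (fib_delta v) q psi.
Proof.
move=> dv dpsi; rewrite /fib_derive /fib_du /fib_delta.
rewrite deriveE; last exact: (differentiable_comp dv dpsi).
rewrite (diff_comp dv dpsi)/= -(deriveE w dv).
rewrite [X in 'd psi _ X = _](row_sum_delta ('D_w v q)) linear_sum -sumrN.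
apply: eq_bigr => j _; rewrite linearZ/= mulrN opprK.
by rewrite -deriveE.
Qed.

End KineticEquation.

(* Main.v *)
(* At a fixed (x, t) the ansatz is a distribution in u of order N supported at
   the point v(x, t).  Moving the (x, t)-derivatives from the test function phi
   onto this family of distributions (the space-time integral of the derivative
   of a compactly supported function vanishes) turns the weak form of the
   conservation law into the integral over D of [residual phi], where, for each
   (x, t), [residual] is a distribution in u supported at v(x, t), of order at
   most N + 1.  The center equation cancels its terms of order N + 1, so it only
   sees the N-jet of phi at v(x, t), and phi may be replaced by its Taylor
   polynomial of degree N.  On the monomials (u - v)^k with k <= N, [residual]
   vanishes by the moment hierarchy. *)

From HB Require Import structures.
Require Import Defs.
From mathcomp Require Import all_boot all_order all_algebra.
From mathcomp Require Import all_classical all_reals all_analysis.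
From mathcomp Require Import measurable_realfun ring.
Set Implicit Arguments.
Unset Strict Implicit.
Unset Printing Implicit Defensive.
Import Order.TTheory GRing.Theory Num.Theory.
Import numFieldNormedType.Exports.
Local Open Scope classical_set_scope.
Local Open Scope ring_scope.

(** * Smooth functions *)

(** The hypothesis and the conclusion speak of different objects: the moment hierarchy uses the
    fibrewise [fib_ansatz], the conclusion the functional [ansatz]. Both reduce to one concrete
    function of (x, t), [pairing], a finite sum of u-derivatives of the test function at the center
    ([fib_ansatzE], [ansatzE]); what remains is calculus with smooth functions. Order N + 1 appears
    because a derivative in (x, t) also moves the center, which costs one more u-derivative, and
    because the flux F brings one of its own. On a function with vanishing N-jet Leibniz' rule
    evaluates G and F at the center, so that all these terms carry the common factor d_t v + G .
    grad v - F. The 1/a! of the ansatz fits a sum over all index tuples because the rearrangements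
    of a tuple, weighted by the derivatives of the monomial, count a! in total
    ([sum_perm_count]). *)

Section SmoothGeneral.
Variables (R : realType) (V W : normedModType R).
Implicit Types (f g : V -> W) (D : set V).

(** Rules of calculus are available only on [D], so functions get replaced by others that agree
    merely near a point. The expansion of [f] at [x] serves for [g], and [diff_unique] identifies
    the two differentials. *)
Lemma near_eq_differentiable f g (x : V) :
  (\near x, f x = g x) -> differentiable f x -> differentiable g x.
Proof.
move=> fg df; have fgx := nbhs_singleton fg.
have H : g \o shift x = cst (g x) + 'd f x +o_ 0 id.
  apply/eqaddoP.
  move=> e e0.
  have /eqaddoP := diff_locally df.
  move=> /(_ e e0).
  have : \forall h \near (0 : V), f (h + x) = g (h + x).
    by move: fg; rewrite (near_shift 0)/=; apply: filterS => h; rewrite subr0.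
  by apply: filterS2 => h; rewrite !fctE/= fgx => ->.
apply/diff_locallyP; rewrite (diff_unique (diff_continuous df) H); split=> //.
exact: diff_continuous.
Qed.

Lemma open_near D (P : V -> Prop) x :
  open D -> D x -> (forall y, D y -> P y) -> \near x, P x.
Proof. by move=> oD Dx DP; apply: filterS (open_nbhs_nbhs (conj oD Dx)). Qed.

Lemma derive_open D f g w p : open D -> (forall q, D q -> f q = g q) -> D p ->
  'D_w f p = 'D_w g p.
Proof. by move=> oD fg Dp; apply: near_eq_derive; exact: open_near oD Dp fg. Qed.

Lemma smooth_differentiable D f p : smooth D f -> D p -> differentiable f p.
Proof. by move=> sf; exact: (sf [::]). Qed.

Lemma smooth_derivable D f w p : smooth D f -> D p -> derivable f p w.
Proof.
by move=> sf Dp; apply: diff_derivable; exact: smooth_differentiable sf _.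
Qed.

Lemma smooth_derive D f w : smooth D f -> smooth D (fun p => 'D_w f p).
Proof.
move=> sf ws p Dp; have := sf (rcons ws w) p Dp.
by rewrite /iter_derive foldr_rcons.
Qed.

(** A class stable under one directional derivative contains all iterated ones. Smoothness proofs
    thus only exhibit a suitable class [P] and never meet [iter_derive]. *)
Lemma smooth_coind D (P : (V -> W) -> Prop) :
  (forall f, P f -> forall p, D p -> differentiable f p) ->
  (forall f w, P f -> P (fun p => 'D_w f p)) ->
  forall f, P f -> smooth D f.
Proof.
move=> Pd PD f Pf ws p Dp; apply: Pd => //.
by elim: ws => //= w ws; exact: PD.
Qed.

Lemma smooth_ext D f g : open D -> (forall p, D p -> f p = g p) ->
  smooth D f -> smooth D g.
Proof.
move=> oD fg sf.
(* Agreement on [D] with some smooth function: as [D] is open, this class is stable under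
   derivation. *)
pose P g := exists2 f, smooth D f & forall p, D p -> f p = g p.
apply: (@smooth_coind D P); last by exists f.
- move=> {sf fg f g} g [f sf fg] p Dp.
  apply: near_eq_differentiable (smooth_differentiable sf Dp).
  exact: open_near fg.
- move=> {sf fg f g} g w [f sf fg]; exists (fun p => 'D_w f p).
    exact: smooth_derive.
  by move=> p Dp; exact: derive_open fg Dp.
Qed.

Lemma smooth_cst D (c : W) : smooth D (fun=> c).
Proof.
pose P f := exists c : W, f = fun=> c.
apply: (@smooth_coind D P); last by exists c.
  by move=> _ [{}c ->] p _.
by move=> _ w [{}c ->]; exists 0; apply/funext => p; rewrite derive_cst.
Qed.

Lemma smooth_linear D (L : {linear V -> W}) : continuous L -> smooth D L.
Proof.
(* Constants join the class because the derivative of a linear map is constant. *)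
move=> cL; pose P f := (exists2 L : {linear V -> W}, continuous L & f = L) \/
  exists c : W, f = fun=> c.
apply: (@smooth_coind D P); last by left; exists L.
  by move=> _ [[{cL}L cL ->]|[{}c ->]] p _//; exact: linear_differentiable.
move=> _ w [[{cL}L cL ->]|[{}c ->]]; right; last first.
  by exists 0; apply/funext => p; rewrite derive_cst.
exists (L w); apply/funext => p; rewrite deriveE ?diff_lin//.
exact: linear_differentiable.
Qed.

End SmoothGeneral.

Section SmoothLinearComp.
Variables (R : realType) (V V' W W' : normedModType R).
Variables (L : {linear W -> W'}) (A : {linear V' -> V}).
Hypotheses (cL : continuous L) (cA : continuous A).

Lemma derive_linear_comp (f : V -> W) w p : differentiable f (A p) ->
  'D_w (fun p => L (f (A p))) p = L ('D_(A w) f (A p)).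
Proof.
move=> df; have dA : differentiable A p by exact: linear_differentiable.
have dfA := differentiable_comp dA df.
have dL : differentiable L (f (A p)) by exact: linear_differentiable.
rewrite deriveE; last exact: (differentiable_comp dfA dL).
by rewrite (diff_comp dfA dL)/= (diff_comp dA df)/= !diff_lin// deriveE.
Qed.

(** The derivative along [w] is [L] applied to the derivative of [f] along [A w], again of the same
    form, but only over the preimage of [D]; the class therefore records equality there only. *)
Lemma smooth_linear_comp (D : set V) (f : V -> W) : open D ->
  smooth D f -> smooth (A @^-1` D) (fun p => L (f (A p))).
Proof.
move=> oD sf.
have oA : open (A @^-1` D) by exact: open_comp.
pose P g := exists2 f, smooth D f & forall p, D (A p) -> g p = L (f (A p)).
apply: (@smooth_coind _ _ _ _ P); last by exists f.
- move=> g [{sf}f sf gf] p Dp.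
  apply: (@near_eq_differentiable _ _ _ (fun p => L (f (A p)))).
    by apply: (open_near oA Dp) => y /gf/esym; exact.
  have df := smooth_differentiable sf Dp.
  have dA : differentiable A p by exact: linear_differentiable.
  have dL : differentiable L (f (A p)) by exact: linear_differentiable.
  exact: (differentiable_comp (differentiable_comp dA df) dL).
- move=> g w [{sf}f sf gf]; exists (fun p => 'D_(A w) f p).
    exact: smooth_derive.
  move=> p Dp; rewrite (derive_open _ oA gf Dp) derive_linear_comp//.
  exact: smooth_differentiable sf _.
Qed.

End SmoothLinearComp.

Section SmoothAlgebra.
Variables (R : realType) (V : normedModType R) (D : set V).
Hypothesis oD : open D.
Implicit Types f g : V -> R.

(* The algebra generated by the smooth functions is stable under derivation, so
   [smooth_coind] yields products without estimating iterated Leibniz sums. *)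
Inductive smooth_alg : (V -> R) -> Prop :=
| SmoothIn f of smooth D f : smooth_alg f
| SmoothD f g of smooth_alg f & smooth_alg g : smooth_alg (fun p => f p + g p)
| SmoothM f g of smooth_alg f & smooth_alg g : smooth_alg (fun p => f p * g p)
| SmoothE f g of (forall p, D p -> f p = g p) & smooth_alg f : smooth_alg g.

Lemma smooth_alg_differentiable f :
  smooth_alg f -> forall p, D p -> differentiable f p.
Proof.
elim=> {f} [f sf|f g _ df _ dg|f g _ df _ dg|f g fg _ df] p Dp.
- exact: smooth_differentiable sf Dp.
- by apply: differentiableD; [exact: df|exact: dg].
- by apply: differentiableM; [exact: df|exact: dg].
- by apply: near_eq_differentiable (df _ Dp); exact: open_near fg.
Qed.

(** Sum and product rules hold only on [D]; [SmoothE] absorbs what happens elsewhere. *)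
Lemma smooth_alg_derive f w : smooth_alg f -> smooth_alg (fun p => 'D_w f p).
Proof.
elim=> {f} [f sf|f g af df ag dg|f g af df ag dg|f g fg af df].
- exact/SmoothIn/smooth_derive.
- apply: SmoothE (SmoothD df dg) => p Dp.
  by rewrite deriveD//; apply: diff_derivable; exact: smooth_alg_differentiable.
- apply: SmoothE (SmoothD (SmoothM af dg) (SmoothM ag df)) => p Dp.
  by rewrite deriveM//; apply: diff_derivable; exact: smooth_alg_differentiable.
- by apply: SmoothE df => p Dp; exact: derive_open fg Dp.
Qed.

Lemma smooth_alg_smooth f : smooth_alg f -> smooth D f.
Proof.
move: f; apply: smooth_coind => [f|f w]; first exact: smooth_alg_differentiable.
exact: smooth_alg_derive.
Qed.

Lemma smoothD f g : smooth D f -> smooth D g -> smooth D (fun p => f p + g p).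
Proof.
move=> sf sg; apply: smooth_alg_smooth.
exact: SmoothD (SmoothIn sf) (SmoothIn sg).
Qed.

Lemma smoothM f g : smooth D f -> smooth D g -> smooth D (fun p => f p * g p).
Proof.
move=> sf sg; apply: smooth_alg_smooth.
exact: SmoothM (SmoothIn sf) (SmoothIn sg).
Qed.

Lemma smooth_scale c f : smooth D f -> smooth D (fun p => c * f p).
Proof. by move=> sf; apply: smoothM => //; exact: smooth_cst. Qed.

Lemma smoothB f g : smooth D f -> smooth D g -> smooth D (fun p => f p - g p).
Proof.
move=> sf sg; have := smoothD sf (smooth_scale (-1) sg).
by apply: smooth_ext => // p _; rewrite mulN1r.
Qed.

Lemma smooth_sum (I : Type) (r : seq I) (f : I -> V -> R) :
  (forall i, smooth D (f i)) -> smooth D (fun p => \sum_(i <- r) f i p).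
Proof.
move=> sf; elim: r => [|i r IH].
  by apply: (smooth_ext oD _ (smooth_cst (D := D) (0 : R))) => p _; rewrite big_nil.
by apply: (smooth_ext oD _ (smoothD (sf i) IH)) => p _; rewrite big_cons.
Qed.

Lemma smooth_prod (I : Type) (r : seq I) (f : I -> V -> R) :
  (forall i, smooth D (f i)) -> smooth D (fun p => \prod_(i <- r) f i p).
Proof.
move=> sf; elim: r => [|i r IH].
  by apply: (smooth_ext oD _ (smooth_cst (D := D) (1 : R))) => p _; rewrite big_nil.
by apply: (smooth_ext oD _ (smoothM (sf i) IH)) => p _; rewrite big_cons.
Qed.

End SmoothAlgebra.

(** * Symmetry of second derivatives *)

Section Schwarz.
Variables (R : realType) (V : normedModType R).
Implicit Types f : V -> R.

Lemma is_derive_line f (x w : V) (s : R) : differentiable f (x + s *: w) ->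
  is_derive s 1 (fun s => f (x + s *: w)) ('D_w f (x + s *: w)).
Proof.
move=> df.
have E : (fun h : R => h^-1 *: (((fun s => f (x + s *: w)) \o shift s) (h *: 1) -
    f (x + s *: w))) =
  (fun h : R => h^-1 *: ((f \o shift (x + s *: w)) (h *: w) - f (x + s *: w))).
  apply/funext => h /=; rewrite [h *: 1]mulr1 scalerDl.
  by rewrite addrCA.
split; first by rewrite /derivable E; exact: diff_derivable.
by rewrite /derive E.
Qed.

Lemma MVT_line f (x w : V) (h : R) : 0 < h ->
  (forall s, 0 <= s <= h -> differentiable f (x + s *: w)) ->
  exists2 s, 0 <= s <= h & f (x + h *: w) - f x = h * 'D_w f (x + s *: w).
Proof.
move=> h0 df.
have [||s] := @MVT R (fun s => f (x + s *: w))
  (fun s => 'D_w f (x + s *: w)) 0 h h0.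
- move=> s; rewrite in_itv/= => /andP[s0 sh]; apply: is_derive_line.
  by apply: df; rewrite !ltW.
- apply: derivable_within_continuous => s; rewrite in_itv/= => s0h.
  exact: (@ex_derive _ _ _ _ _ _ _ (is_derive_line (df _ s0h))).
rewrite in_itv/= => /andP[s0 sh]; rewrite scale0r addr0 subr0 mulrC => ->.
by exists s => //; rewrite !ltW.
Qed.

(** The mean value theorem is used twice: along [a] for the increment of [f] by [h *: b], then along
    [b] for the derivative of [f] along [a]. *)
Lemma second_difference (D : set V) f a b p (h : R) : smooth D f -> 0 < h ->
  (forall s t, 0 <= s <= h -> 0 <= t <= h -> D (p + s *: a + t *: b)) ->
  exists s t, [/\ 0 <= s <= h, 0 <= t <= h &
    f (p + h *: a + h *: b) - f (p + h *: a) - (f (p + h *: b) - f p) =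
    h * (h * 'D_b (fun q => 'D_a f q) (p + s *: a + t *: b))].
Proof.
move=> sf h0 Dst.
have hh : 0 <= h <= h by apply/andP; split=> //; exact: ltW.
have h00 : 0 <= (0 : R) <= h by apply/andP; split=> //; exact: ltW.
have Ds s : 0 <= s <= h -> D (p + s *: a).
  by move=> sh; have := Dst s 0 sh h00; rewrite scale0r addr0.
have dsh s : 0 <= s <= h ->
    differentiable (f \o (fun x => x + h *: b)) (p + s *: a).
  move=> sh.
  have d1 : differentiable (id + cst (h *: b)) (p + s *: a).
    apply: differentiableD; first exact: (@ex_diff _ _ _ _ _ id).
    exact: differentiable_cst.
  have d2 : differentiable f ((id + cst (h *: b)) (p + s *: a)).
    exact: smooth_differentiable sf (Dst _ _ sh hh).
  exact: differentiable_comp d1 d2.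
have Dsh s : 0 <= s <= h ->
   'D_a (f \o (fun x => x + h *: b)) (p + s *: a) = 'D_a f (p + s *: a + h *: b).
  move=> sh; rewrite /derive.
  rewrite (_ : (fun k => _) = (fun k => k^-1 *:
    ((f \o shift (p + s *: a + h *: b)) (k *: a) - f (p + s *: a + h *: b))))//.
  by apply/funext => k/=; rewrite -(addrA (k *: a)).
have [|s sh] := MVT_line (f := fun x => (f \o (fun x => x + h *: b)) x - f x)
  (x := p) (w := a) h0.
  move=> s sh; apply: differentiableB; first exact: dsh.
  exact: smooth_differentiable sf (Ds _ sh).
rewrite deriveB; last 2 first.
- apply: diff_derivable; exact: dsh.
- exact: smooth_derivable sf (Ds _ sh).
rewrite Dsh//= => ->.
have [|t th ->] := MVT_line (f := fun x => 'D_a f x)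
  (x := p + s *: a) (w := b) h0.
  move=> t th.
  exact: smooth_differentiable (smooth_derive a sf) (Dst _ _ sh th).
by exists s, t.
Qed.

(** The second difference over a small parallelogram is symmetric in [a] and [b], and is the square
    of [h] times either mixed derivative at some point of it. Both mixed derivatives are continuous
    at [p], so distinct values there would stay apart nearby. *)
Lemma derive_swap (D : set V) f a b p : open D -> smooth D f -> D p ->
  'D_b (fun q => 'D_a f q) p = 'D_a (fun q => 'D_b f q) p.
Proof.
move=> oD sf Dp; apply/eqP/negPn/negP => ne.
set A := 'D_b _ p in ne; set B := 'D_a _ p in ne.
have e0 : 0 < `|A - B| / 2 by rewrite divr_gt0// normr_gt0 subr_eq0.
have cA : \near p, `|A - 'D_b (fun q => 'D_a f q) p| < `|A - B| / 2.
  have /differentiable_continuous/cvgrPdist_lt/(_ _ e0)// :=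
    smooth_differentiable (smooth_derive b (smooth_derive a sf)) Dp.
have cB : \near p, `|B - 'D_a (fun q => 'D_b f q) p| < `|A - B| / 2.
  have /differentiable_continuous/cvgrPdist_lt/(_ _ e0)// :=
    smooth_differentiable (smooth_derive a (smooth_derive b sf)) Dp.
have nD : \near p, D p by apply: open_near oD Dp _.
have [d /= d0 dP] := (nbhs_ballP _ _).1 (filterI nD (filterI cA cB)).
(* With this [h] the parallelogram stays within distance [d / 2] of [p]; the [+ 1] keeps the
   denominator positive when [a] and [b] vanish. *)
pose h := d / 2 / (`|a| + `|b| + 1).
have n0 : 0 < `|a| + `|b| + 1 by rewrite ltr_wpDl// addr_ge0.
have h0 : 0 < h by rewrite !divr_gt0.
have hst s t : 0 <= s <= h -> 0 <= t <= h -> ball p d (p + s *: a + t *: b).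
  move=> /andP[s0 sh] /andP[t0 th].
  rewrite -ball_normE/= -addrA opprD addrA subrr sub0r normrN.
  apply: le_lt_trans (ler_normD _ _) _; rewrite !normrZ !ger0_norm//.
  apply: (@le_lt_trans _ _ (h * (`|a| + `|b| + 1))).
    rewrite !mulrDr mulr1 -[leLHS]addr0 lerD//; last exact: ltW.
    by rewrite lerD// ler_wpM2r.
  by rewrite /h divfK ?gt_eqF// gtr_pMr// invf_lt1// ltr1n.
have hD s t (sh : 0 <= s <= h) (th : 0 <= t <= h) : D (p + s *: a + t *: b).
  by have [] := dP _ (hst s t sh th).
have hts s' t' (s'h : 0 <= s' <= h) (t'h : 0 <= t' <= h) :
    D (p + s' *: b + t' *: a).
  by rewrite addrAC; exact: hD.
have [s [t [sh th E1]]] := @second_difference D f a b p h sf h0 hD.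
have [s' [t' [s'h t'h E2]]] := @second_difference D f b a p h sf h0 hts.
have [_ [ /= PA _]] := dP _ (hst _ _ sh th).
have [_ [ /= _ PB]] := dP _ (hst _ _ t'h s'h).
have Rg (x y z w : R) : x - y - (z - w) = x - z - (y - w) by ring.
have hn : h != 0 by rewrite gt_eqF.
have E : 'D_b (fun q => 'D_a f q) (p + s *: a + t *: b) =
  'D_a (fun q => 'D_b f q) (p + t' *: a + s' *: b).
  apply: (mulfI hn); apply: (mulfI hn).
  have e1 : p + h *: a + h *: b = p + h *: b + h *: a by rewrite addrAC.
  have e2 : p + t' *: a + s' *: b = p + s' *: b + t' *: a by rewrite addrAC.
  rewrite e2; apply: etrans (esym E1) _; apply: etrans (Rg _ _ _ _) _.
  by rewrite e1; exact: E2.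
have half (x y z : R) : `|x - z| < `|x - y| / 2 -> `|y - z| < `|x - y| / 2 ->
    False.
  move=> xz yz; have : `|x - y| < `|x - y|; last by rewrite ltxx.
  apply: le_lt_trans (ler_distD z x y) _.
  rewrite [ltRHS]splitr; apply: ltrD; first exact: xz.
  by rewrite -normrN opprB; exact: yz.
by apply: half PA _; rewrite E.
Qed.

End Schwarz.

(** * Integration over space-time *)

Section CompactlySupported.
Variables (R : realType).

Definition unif_cont (V : normedModType R) (f : V -> R) : Prop :=
  forall e : R, 0 < e -> exists2 r : R, 0 < r &
    forall x y : V, `|x - y| < r -> `|f x - f y| < e.

(** Uniform continuity is what makes partial integrals continuous again. The support is recorded by
    a radius, which slices keep and shifts enlarge by a known amount. *)
Definition Cc (V : normedModType R) (M : R) (f : V -> R) : Prop :=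
  unif_cont f /\ forall x, M < `|x| -> f x = 0.

Lemma unif_cont_continuous (V : normedModType R) (f : V -> R) :
  unif_cont f -> continuous f.
Proof.
move=> uf x; apply/cvgrPdist_lt => e e0; have [r r0 fr] := uf e e0.
by apply/nbhs_normP; exists r => //= y; exact: fr.
Qed.

Lemma Cc_le (V : normedModType R) (M M' : R) (f : V -> R) : M <= M' ->
  Cc M f -> Cc M' f.
Proof. by move=> MM [uf f0]; split=> // x /(le_lt_trans MM); exact: f0. Qed.

Lemma CcD (V : normedModType R) (M c : R) (f g : V -> R) :
  Cc M f -> Cc M g -> Cc M (fun x => f x + c * g x).
Proof.
move=> [uf f0] [ug g0]; split; last by move=> x Mx; rewrite f0// g0// mulr0 addr0.
move=> e e0.
have c0 : 0 < `|c| + 1 by rewrite ltr_wpDl.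
have [r r0 fr] := uf (e / 2) (divr_gt0 e0 (ltr0Sn R 1)).
have [s s0 gs] := ug (e / 2 / (`|c| + 1))
  (divr_gt0 (divr_gt0 e0 (ltr0Sn R 1)) c0).
exists (Num.min r s); first by rewrite lt_min r0.
move=> x y; rewrite lt_min => /andP[/fr fxy /gs gxy].
rewrite (_ : _ - _ = (f x - f y) + c * (g x - g y)); last by ring.
rewrite (splitr e); apply: le_lt_trans (ler_normD _ _) _; apply: ltr_leD => //.
rewrite normrM (@le_trans _ _ ((`|c| + 1) * `|g x - g y|))//.
  by rewrite ler_wpM2r// lerDl.
by rewrite mulrC -ler_pdivlMr// ltW.
Qed.

Lemma Cc_shift (V : normedModType R) (M : R) (f : V -> R) (w : V) :
  Cc M f -> Cc (M + `|w|) (fun x => f (x + w)).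
Proof.
move=> [uf f0]; split.
  move=> e e0; have [r r0 fr] := uf e e0; exists r => // x y xy; apply: fr.
  by rewrite opprD addrACA subrr addr0.
move=> x Mx; apply: f0; rewrite -ltrBDr in Mx; apply: lt_le_trans Mx _.
by rewrite lerBlDr -{1}(addrK w x) -(normrN w) ler_normD.
Qed.

(** [M] depends on [K] alone, so that all integrands supported in [K] share one radius. The
    near-covering form of compactness gives a modulus valid at all points of [K]; a pair with one
    point in [K] is treated from that point, and a pair outside [K] has both values zero. *)
Lemma compact_supp_Cc (V : normedModType R) (K : set V) :
  compact K -> exists M, forall f : V -> R,
  continuous f -> (forall x, ~ K x -> f x = 0) -> Cc M f.
Proof.
move=> cK; have [M [_ KM]] := compact_bounded cK.
exists (M + 1) => f cf f0; split; last first.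
  move=> x Mx; apply: f0 => Kx; have := KM (M + 1).
  by rewrite ltrDl => /(_ ltr01 _ Kx)/=; rewrite leNgt Mx.
move=> e e0.
have H : \forall r \near 0^'+, K `<=`
    [set x | forall y, `|x - y| < r -> `|f x - f y| < e].
  apply: (compact_near_coveringP K).1 => // x Kx.
  have /cvgrPdist_lt/(_ _ (divr_gt0 e0 (ltr0Sn R 1)))/nbhs_normP[s /= s0 fs] := cf x.
  exists (ball x (s / 2), [set r | r < s / 2]).
    split=> /=; first by apply: nbhsx_ballx; rewrite divr_gt0.
    by apply: nbhs_right_lt; rewrite divr_gt0.
  move=> [x' r] /= [xx' rs] y x'y.
  rewrite -ball_normE/= in xx'.
  rewrite -(subrKA (f x)) (splitr e) (le_lt_trans (ler_normD _ _))//.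
  rewrite ltrD//; last first.
    apply: fs => /=; rewrite -(subrKA x') (splitr s).
    by rewrite (le_lt_trans (ler_normD _ _))// ltrD// (lt_trans x'y).
  rewrite distrC; apply: fs => /=.
  by rewrite (lt_trans xx')// gtr_pMr// invf_lt1// ltr1n.
have [r /= [r0 Kr]] : exists r : R, 0 < r /\ K `<=`
    [set x | forall y, `|x - y| < r -> `|f x - f y| < e].
  have [r [ ? ?]] := filter_ex (filterI (nbhs_right_gt 0) H).
  by exists r.
exists r => // x y xy.
have [Kx|nKx] := pselect (K x); first exact: Kr.
have [Ky|nKy] := pselect (K y).
  by rewrite distrC; apply: Kr => //; rewrite distrC.
by rewrite !f0// subrr normr0.
Qed.

(* Functionals behaving like integration of compactly supported functions
   against a locally finite translation-invariant measure. *)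
Definition Haar_like (V : normedModType R) (J : (V -> R) -> R) : Prop :=
  [/\ forall M c f g, Cc M f -> Cc M g ->
        J (fun x => f x + c * g x) = J f + c * J g,
      forall M, exists2 B : R, 0 <= B & forall f (e : R), Cc M f ->
        (forall x, `|f x| <= e) -> `|J f| <= B * e &
      forall M f w, Cc M f -> J (fun x => f (x + w)) = J f].

Lemma Haar_like0 (V : normedModType R) (J : (V -> R) -> R) :
  Haar_like J -> J (fun=> 0) = 0.
Proof.
case=> Jl _ _.
have C0 : Cc 0 ((fun=> 0) : V -> R).
  by split=> // e e0; exists 1 => // x y _; rewrite subrr normr0.
have E := Jl 0 (-1) _ _ C0 C0.
transitivity (J (fun=> 0) + -1 * J (fun=> 0)); last by rewrite mulN1r subrr.
by rewrite -E; congr J; apply/funext => x; rewrite mulr0 addr0.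
Qed.

Lemma Haar_likeB (V : normedModType R) (J : (V -> R) -> R) M f g :
  Haar_like J -> Cc M f -> Cc M g -> J f - J g = J (fun x => f x - g x).
Proof.
case=> Jl _ _ cf cg; rewrite -[- J g]mulN1r -(Jl M)//.
by congr J; apply/funext => x; rewrite mulN1r.
Qed.


(** The inductive step of iterated integration; [j] stands for [row_mx] as well as for pairing. The
    max norm lets slices and partial integrals inherit the radius [M], and the bound on [J] turns
    the uniform continuity of [f] into that of its partial integral, to which [I] is then
    applied. *)
Lemma Haar_like_layer (V W : normedModType R) (j : R -> V -> W)
    (I : (R -> R) -> R) (J : (V -> R) -> R) :
  (forall s x, `|j s x| = Num.max `|s| `|x|) ->
  (forall s t x y, j (s + t) (x + y) = j s x + j t y) ->
  (forall w, exists s x, w = j s x) ->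
  Haar_like I -> Haar_like J ->
  Haar_like (fun f : W -> R => I (fun s => J (fun x => f (j s x)))).
Proof.
move=> jn jD jsurj hI hJ.
have [Il Ib It] := hI; have [Jl Jb Jt] := hJ.
have jB s t x y : j s x - j t y = j (s - t) (x - y).
  by apply/eqP; rewrite subr_eq -jD !subrK.
have slice M f s : Cc M f -> Cc M (fun x => f (j s x)).
  move=> [uf f0]; split.
    move=> e e0; have [r r0 fr] := uf e e0; exists r => // x y xy; apply: fr.
    by rewrite jB subrr jn normr0 max_r.
  by move=> x Mx; apply: f0; rewrite jn lt_max Mx orbT.
have outer M f : Cc M f -> Cc M (fun s => J (fun x => f (j s x))).
  move=> cf; have [uf f0] := cf; split.
    move=> e e0; have [B B0 HB] := Jb M.
    have B1 : 0 < B + 1 by rewrite ltr_wpDl.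
    have [r r0 fr] := uf (e / (B + 1)) (divr_gt0 e0 B1).
    exists r => // s t st.
    rewrite (Haar_likeB hJ (slice _ _ s cf) (slice _ _ t cf)).
    apply: (@le_lt_trans _ _ (B * (e / (B + 1)))).
      apply: HB.
        have -> : (fun x => f (j s x) - f (j t x)) =
            (fun x => f (j s x) + -1 * f (j t x)).
          by apply/funext => x; rewrite mulN1r.
        by apply: CcD; exact: slice.
      by move=> x; apply/ltW/fr; rewrite jB subrr jn normr0 max_l.
    by rewrite mulrA ltr_pdivrMr// mulrC ltr_pM2l// ltrDl.
  move=> s Ms; rewrite -[RHS](Haar_like0 hJ); congr J; apply/funext => x.
  by apply: f0; rewrite jn lt_max Ms.
split.
- move=> M c f g cf cg; rewrite -(Il M)//; last 2 first.
  + exact: outer.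
  + exact: outer.
  congr I; apply/funext => s; rewrite -(Jl M)//; exact: slice.
- move=> M; have [B B0 HB] := Ib M; have [B' B'0 HB'] := Jb M.
  exists (B * B'); first exact: mulr_ge0.
  move=> f e cf fe; rewrite -mulrA; apply: HB; first exact: outer.
  by move=> s; apply: HB' => //; exact: slice.
- move=> M f w cf; have [a [b ->]] := jsurj w.
  rewrite -[RHS](It M _ a) //; last exact: outer.
  congr I; apply/funext => s.
  rewrite -[RHS](Jt M _ b) //; last exact: slice.
  by congr J; apply/funext => x; rewrite jD.
Qed.

Local Notation mu := (@lebesgue_measure R).

Lemma Cc_integrable M (f : R -> R) : Cc M f -> mu.-integrable setT (EFin \o f).
Proof.
move=> [uf f0].
have -> : EFin \o f = (EFin \o f) \_ `[- M, M].
  apply/funext => x; rewrite patchE; case: ifPn => //=.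
  rewrite notin_setE/= in_itv/= => /negP; rewrite -ler_norml -ltNge => /f0 ->//.
apply: (integrable_mkcond _ _).1 => //.
apply: (@continuous_compact_integrable R f); first exact: segment_compact.
by apply: continuous_subspaceT; exact: unif_cont_continuous.
Qed.

(** Both measures give half-open intervals their length, and Lebesgue measure is unique with this
    property. *)
Lemma lebesgue_measure_shift (w : R) (A : set R) : measurable A ->
  pushforward mu (fun x : measurableTypeR R => (x + w : measurableTypeR R)) A
  = mu A.
Proof.
move=> mA; have mw : measurable_fun [set: measurableTypeR R]
   (fun x : measurableTypeR R => (x + w : measurableTypeR R)).
  by apply: measurable_funD => //; exact: measurable_cst.
pose phi := MeasurableFun.Pack
  (MeasurableFun.Class (isMeasurableFun.Build _ _ _ _ _ mw)).
apply/esym.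
apply: (@lebesgue_measure_unique R (pushforward mu phi)) => //= _ [[a b]] _ <-.
rewrite /pushforward/=.
have -> : (fun x => x + w) @^-1` `]a, b]%classic = `]a - w, b - w]%classic.
  by apply/seteqP; split => x /=; rewrite !in_itv/= ltrBlDr lerBrDr.
rewrite !lebesgue_measure_itv/= !lte_fin ltrBlDr subrK.
by case: ifP => // _; rewrite -!EFinB; congr (_%:E); ring.
Qed.

Lemma Haar_like_lebesgue : Haar_like (fun f : R -> R => \int[mu]_s f s).
Proof.
split.
- move=> M c f g cf cg.
  have C0 : Cc M ((fun=> 0) : R -> R).
    by split=> // e e0; exists 1 => // x y _; rewrite subrr normr0.
  have cgi := Cc_integrable (CcD c C0 cg).
  have cgi' : mu.-integrable setT (EFin \o (fun s => c * g s)).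
    rewrite (_ : EFin \o _ = EFin \o (fun s => 0 + c * g s))//.
    by apply/funext => x /=; rewrite add0r.
  have fi := Cc_integrable cf; have gi := Cc_integrable cg.
  by rewrite RintegralD// RintegralZl.
- move=> M; exists (fine (mu `[- M, M])); first exact: fine_ge0.
  move=> f e cf fe.
  have fi := Cc_integrable cf.
  have E : \int[mu]_s f s = \int[mu]_(s in `[- M, M]) f s.
    rewrite [RHS]Rintegral_mkcond; congr Rintegral; apply/funext => x.
    rewrite patchE; case: ifPn => //.
    rewrite notin_setE/= in_itv/= => /negP; rewrite -ler_norml -ltNge.
    by case: cf => _ /[apply].
  have fiM : mu.-integrable `[- M, M] (EFin \o f).
    by apply: integrableS fi.
  rewrite E (le_trans (le_normr_Rintegral _ _))//.
  rewrite mulrC -(Rintegral_cst mu); last exact: measurable_itv.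
  apply: le_Rintegral => //.
    exact: (integrable_norm fiM).
  by apply: (@continuous_compact_integrable R (fun=> e)); [exact: segment_compact|
    apply: continuous_subspaceT => x; exact: cvg_cst].
- move=> M f w cf; rewrite /Rintegral; congr fine.
  have mw : measurable_fun [set: measurableTypeR R]
     (fun x : measurableTypeR R => (x + w : measurableTypeR R)).
    by apply: measurable_funD => //; exact: measurable_cst.
  have fi := Cc_integrable cf.
  have fwi := Cc_integrable (Cc_shift w cf).
  have := @integral_pushforward _ _ _ _ R _ mw mu setT (EFin \o f).
  rewrite preimage_setT => <- //; last exact: (measurable_int _ fi).
  by apply: eq_measure_integral => A mA _; exact: lebesgue_measure_shift.
Qed.

Lemma mx_norm_le m n (A : 'M[R]_(m, n)) (e : R) : 0 <= e ->
  (forall i k, `|A i k| <= e) -> `|A| <= e.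
Proof.
by move=> e0 Ae; rewrite /Num.Def.normr/= mx_normrE; apply: bigmax_le.
Qed.

Lemma mx_norm_ge m n (A : 'M[R]_(m, n)) i k : `|A i k| <= `|A|.
Proof.
by rewrite [leRHS]/Num.Def.normr/= mx_normrE; exact: (le_bigmax _ _ (i, k)).
Qed.

Lemma norm_row_mx n (s : R) (x : 'rV[R]_n) :
  `|row_mx (s%:M : 'rV[R]_1) x| = Num.max `|s| `|x|.
Proof.
apply/eqP; rewrite eq_le ge_max; apply/and3P; split.
- apply: mx_norm_le => [|i k]; first by rewrite le_max normr_ge0.
  rewrite mxE; case: (fintype.split k) => l; rewrite le_max.
    by rewrite !mxE !ord1 eqxx mulr1n lexx.
  by rewrite mx_norm_ge orbT.
- have := mx_norm_ge (row_mx (s%:M : 'rV[R]_1) x) 0 (lshift n 0).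
  by rewrite row_mxEl mxE eqxx mulr1n.
- apply: mx_norm_le => // i k.
  have := mx_norm_ge (row_mx (s%:M : 'rV[R]_1) x) i (rshift 1 k).
  by rewrite row_mxEr.
Qed.

Lemma Haar_like_rV_integral n : Haar_like (@rV_integral R n).
Proof.
elim: n => [|n IH] /=.
- split=> //.
    by move=> M; exists 1 => // f e _; rewrite mul1r; exact.
  by move=> M f w _; congr f; rewrite [w]thinmx0 addr0.
- apply: (@Haar_like_layer _ 'rV[R]_n.+1
     (fun s x => row_mx (s%:M : 'rV[R]_1) x : 'rV[R]_(1 + n))
     _ _ _ _ _ Haar_like_lebesgue IH).
  + exact: norm_row_mx.
  + by move=> s t x y; rewrite raddfD/= -add_row_mx.
  + move=> w; exists (w 0 0), (rsubmx (w : 'rV[R]_(1 + n))).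
    have E : lsubmx (w : 'rV[R]_(1 + n)) = (w 0 0)%:M.
      by rewrite [LHS]mx11_scalar mxE; congr ((w _ _)%:M); apply: val_inj.
    by rewrite -E hsubmxK.
Qed.

Lemma Haar_like_spacetime d : Haar_like
  (fun f : 'rV[R]_d * R -> R => \int[mu]_t rV_integral (fun x => f (x, t))).
Proof.
apply: (@Haar_like_layer _ _ (fun t x => (x, t)) _ _ _ _ _
  Haar_like_lebesgue (Haar_like_rV_integral d)).
- by move=> t x; rewrite prod_normE maxC.
- by [].
- by move=> [x t]; exists t, x.
Qed.

(* Translation invariance makes the integral of every difference quotient
   vanish; the quotients converge uniformly to the derivative. *)
Lemma Haar_like_derive (V : normedModType R) (J : (V -> R) -> R) M h w :
  Haar_like J -> Cc M h -> (forall x, differentiable h x) ->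
  Cc M (fun x => 'D_w h x) -> J (fun x => 'D_w h x) = 0.
Proof.
move=> hJ ch dh cD; have [Jl Jb Jt] := hJ.
have [B B0 HB] := Jb (M + `|w|).
have MM : M <= M + `|w| by rewrite lerDl.
suff JB e : 0 < e -> `|J (fun x => 'D_w h x)| <= B * e.
  apply/eqP; rewrite -normr_le0 leNgt; apply/negP => J0.
  have B1 : 0 < B + 1 by rewrite ltr_wpDl.
  have := JB _ (divr_gt0 J0 B1); apply/negP; rewrite -ltNge mulrA ltr_pdivrMr//.
  by rewrite mulrC ltr_pM2l// ltrDl.
move=> e0; have [r r0 Dr] := cD.1 e e0.
have w1 : 0 < `|w| + 1 by rewrite ltr_wpDl.
(* [t <= 1] keeps the shifted function within radius [M + |w|], and [t * |w| < r] puts the mean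
   value point within the modulus of continuity of the derivative. *)
pose t := Num.min 1 (r / (`|w| + 1)).
have t0 : 0 < t by rewrite lt_min ltr01 divr_gt0.
have tw : t * `|w| < r.
  apply: (@le_lt_trans _ _ (r / (`|w| + 1) * `|w|)).
    by rewrite ler_wpM2r// ge_min lexx orbT.
  by rewrite -mulrA -[ltRHS]mulr1 ltr_pM2l// mulrC ltr_pdivrMr// mul1r ltrDl.
have ch' : Cc (M + `|w|) h := Cc_le MM ch.
have chw : Cc (M + `|w|) (fun x => h (x + t *: w)).
  apply: Cc_le (Cc_shift _ ch); rewrite lerD2l normrZ gtr0_norm//.
  by rewrite ler_piMl// ge_min lexx.
have cq := CcD (-1) chw ch'.
have cD' := Cc_le MM cD.
have -> : J (fun x => 'D_w h x) =
    J (fun x => 'D_w h x + (- t^-1) * (h (x + t *: w) + -1 * h x)).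
  rewrite (Jl _ _ _ _ cD' cq) (Jl _ _ _ _ chw ch') (Jt _ _ _ ch).
  by rewrite mulN1r subrr mulr0 addr0.
apply: HB => [|x]; first exact: CcD.
have [|s /andP[s0 st] E] := MVT_line (f := h) (x := x) (w := w) t0.
  by move=> s _; exact: dh.
rewrite mulN1r E mulNr mulKf ?gt_eqF// ltW//; apply: Dr.
rewrite opprD addrA subrr sub0r normrN normrZ ger0_norm//.
by apply: le_lt_trans tw; rewrite ler_wpM2r.
Qed.

End CompactlySupported.

(** * Compactly supported integrands on an open space-time domain *)

Section SpacetimeIntegral.
Variables (R : realType) (d : nat).
Notation spacetime := (spacetime_of R d).
Variables (D K : set spacetime).
Hypotheses (oD : open D) (cK : compact K) (KD : K `<=` D).

Definition supp_cont (h : spacetime -> R) : Prop :=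
  (forall q, D q -> {for q, continuous h}) /\
  forall q, D q -> ~ K q -> h q = 0.

Let oCK : open (~` K).
Proof.
rewrite openC; apply: (compact_closed _ cK).
exact: norm_hausdorff.
Qed.

Lemma patch_near0 (h : spacetime -> R) q :
  (forall q, D q -> ~ K q -> h q = 0) -> ~ D q -> \near q, (h \_ D) q = 0.
Proof.
move=> h0 nDq.
apply: (open_near oCK); first by move=> /KD.
move=> x nKx; rewrite patchE; case: ifPn => // /set_mem Dx; exact: h0.
Qed.

Lemma patch_near (h : spacetime -> R) q : D q -> \near q, h q = (h \_ D) q.
Proof.
by move=> Dq; apply: (open_near oD Dq) => x Dx; rewrite patchE mem_set.
Qed.

(** The open sets [D] and the complement of [K] cover space-time. On the first the extension by zero
    agrees with [h], on the second it vanishes, so it is continuous everywhere although [h] is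
    controlled on [D] only. *)
Lemma supp_cont_Cc : exists M, forall h, supp_cont h -> Cc M (h \_ D).
Proof.
have [M HM] := compact_supp_Cc cK.
exists M => h [ch h0]; apply: HM; last first.
  move=> q nKq; rewrite patchE; case: ifPn => // /set_mem Dq; exact: h0.
move=> q; have [Dq|nDq] := pselect (D q).
  have hq := patch_near h Dq.
  rewrite /prop_for/continuous_at -(nbhs_singleton hq).
  by apply: cvg_trans (ch q Dq); apply: near_eq_cvg.
have hq := patch_near0 h0 nDq.
rewrite /prop_for/continuous_at (nbhs_singleton hq).
exact: cvg_near_cst hq.
Qed.

Lemma spacetime_integral_eq h g : (forall q, D q -> h q = g q) ->
  spacetime_integral D h = spacetime_integral D g.
Proof.
move=> hg; rewrite /spacetime_integral.
suff -> : h \_ D = g \_ D by [].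
by apply/funext => q; rewrite !patchE; case: ifPn => // /set_mem/hg.
Qed.

Lemma spacetime_integralD c h g : supp_cont h -> supp_cont g ->
  spacetime_integral D (fun q => h q + c * g q) =
  spacetime_integral D h + c * spacetime_integral D g.
Proof.
move=> sh sg; have [M HM] := supp_cont_Cc.
have [Jl _ _] := Haar_like_spacetime R d.
rewrite /spacetime_integral -(Jl M _ _ _ (HM _ sh) (HM _ sg)).
congr Rintegral; apply/funext => t; congr rV_integral; apply/funext => x.
by rewrite !patchE; case: ifPn => //; rewrite mulr0 addr0.
Qed.

Lemma supp_contD c h g : supp_cont h -> supp_cont g ->
  supp_cont (fun q => h q + c * g q).
Proof.
move=> [ch h0] [cg g0]; split=> q Dq; last first.
  by move=> nKq; rewrite h0// g0// mulr0 addr0.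
apply: continuousD; first exact: ch.
by apply: continuousM; [exact: cvg_cst|exact: cg].
Qed.

Lemma supp_cont0 : supp_cont (fun=> 0).
Proof. by split=> // q _; exact: cvg_cst. Qed.

Lemma spacetime_integral0 : spacetime_integral D (fun=> 0) = 0.
Proof.
rewrite -[RHS](subrr (spacetime_integral D (fun=> 0))) -mulN1r.
rewrite -(spacetime_integralD _ supp_cont0 supp_cont0).
congr spacetime_integral.
by apply/funext => q; rewrite mulr0 addr0.
Qed.

Lemma spacetime_integral_sum (I : Type) (r : seq I) (c : I -> R)
    (h : I -> spacetime -> R) : (forall i, supp_cont (h i)) ->
  supp_cont (fun q => \sum_(i <- r) c i * h i q) /\
  spacetime_integral D (fun q => \sum_(i <- r) c i * h i q) =
  \sum_(i <- r) c i * spacetime_integral D (h i).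
Proof.
move=> sh; elim: r => [|i r [IHs IH]].
  under eq_fun do rewrite big_nil; rewrite big_nil.
  by split; [exact: supp_cont0|exact: spacetime_integral0].
under eq_fun do rewrite big_cons addrC; rewrite big_cons addrC -IH.
by split; [exact: supp_contD|exact: spacetime_integralD].
Qed.

Lemma spacetime_integral_bigsum (I : Type) (r : seq I)
    (h : I -> spacetime -> R) : (forall i, supp_cont (h i)) ->
  supp_cont (fun q => \sum_(i <- r) h i q) /\
  spacetime_integral D (fun q => \sum_(i <- r) h i q) =
  \sum_(i <- r) spacetime_integral D (h i).
Proof.
move=> sh; have := spacetime_integral_sum r (fun=> 1) sh.
under eq_fun do under eq_bigr do rewrite mul1r.
by under [in X in _ /\ _ = X]eq_bigr do rewrite mul1r.
Qed.

(** The support stays away from the boundary of [D], so extension by zero commutes with derivation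
    and [Haar_like_derive] applies on the whole space. *)
Lemma spacetime_integral_derive w h :
  (forall q, D q -> differentiable h q) ->
  (forall q, D q -> ~ K q -> h q = 0) ->
  (forall q, D q -> {for q, continuous (fun q => 'D_w h q)}) ->
  supp_cont (fun q => 'D_w h q) /\
  spacetime_integral D (fun q => 'D_w h q) = 0.
Proof.
move=> dh h0 cD.
have sD : supp_cont (fun q => 'D_w h q).
  split=> // q Dq nKq; rewrite -(derive_cst (0 : R) q w).
  have oDK : open (D `&` ~` K) by apply: openI.
  by apply: (derive_open _ oDK) => // x [Dx nKx]; exact: h0.
split=> //; have [M HM] := supp_cont_Cc.
have sh : supp_cont h.
  by split=> // q Dq; apply: differentiable_continuous; exact: dh.
have E : (fun q => 'D_w h q) \_ D = (fun q => 'D_w (h \_ D) q).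
  apply/funext => q; rewrite patchE; case: ifPn => [/set_mem Dq|/negP nDq].
    by apply: near_eq_derive; exact: patch_near.
  have nDq' : ~ D q by move=> /mem_set.
  suff -> : 'D_w (h \_ D) q = 0 by [].
  rewrite -(derive_cst (0 : R) q w); apply: near_eq_derive.
  exact: patch_near0 h0 nDq'.
rewrite /spacetime_integral E.
apply: (Haar_like_derive (M := M) (Haar_like_spacetime R d)).
- exact: HM.
- move=> q; have [Dq|nDq] := pselect (D q).
    by apply: near_eq_differentiable (dh q Dq); exact: patch_near.
  apply: (@near_eq_differentiable _ _ _ (fun=> 0)); last exact: differentiable_cst.
  by apply: filterS (patch_near0 h0 nDq) => x ->.
- by rewrite -E; exact: HM.
Qed.

End SpacetimeIntegral.

(** * Monomials and multi-indices *)

Section PermCount.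
Variables (T : finType).
Implicit Types (I s : seq T).

(* The value at the center of the [I]-derivative of the monomial indexed by
   [s]. *)
Definition perm_count I s : nat :=
  if perm_eq I s then (\prod_(x : T) (count_mem x s)`!)%N else 0%N.

Lemma perm_count_nil s : perm_count [::] s = (s == [::]).
Proof.
rewrite /perm_count perm_sym; case: eqVneq => [->|s0].
  by rewrite perm_refl big1.
by case: perm_nilP s0 => // ->; rewrite eqxx.
Qed.

Lemma perm_count_sym I s : perm_count I s = perm_count s I.
Proof.
rewrite /perm_count perm_sym; case: ifP => // /permP e.
by apply: eq_bigr => x _; rewrite e.
Qed.

(** This recursion mirrors the power rule [derive_vmono]: differentiating along [i] brings down the
    multiplicity of [i] and removes one factor. *)
Lemma perm_count_cons i I s :
  perm_count (i :: I) s = (count_mem i s * perm_count I (rem i s))%N.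
Proof.
rewrite /perm_count; have [si|si] := boolP (i \in s); last first.
  rewrite (count_memPn si) mul0n; case: ifP => // /perm_mem/(_ i).
  by rewrite inE eqxx (negPf si).
have e := perm_to_rem si; rewrite (permPr e) perm_cons.
case: ifP; last by rewrite muln0.
move=> _; rewrite (bigD1 i)//= [in RHS](bigD1 i)//= mulnA.
have ce x : count_mem x s = ((i == x) + count_mem x (rem i s))%N.
  by rewrite (permP e).
rewrite !ce eqxx add1n factS; congr (_ * _)%N.
by apply: eq_bigr => x xi; rewrite ce eq_sym (negPf xi).
Qed.

End PermCount.

Lemma big_tuple_cons (R : nmodType) (T : finType) k (F : seq T -> R) :
  \sum_(I : k.+1.-tuple T) F I = \sum_(i : T) \sum_(I : k.-tuple T) F (i :: I).
Proof.
rewrite pair_big/= (reindex (fun p : T * k.-tuple T => cons_tuple p.1 p.2))//=.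
exists (fun t : k.+1.-tuple T => (thead t, behead_tuple t)).
  by move=> [i I] _; congr pair; apply: val_inj.
by move=> t _; rewrite [RHS]tuple_eta; apply: val_inj.
Qed.

(** The rearrangements of [s] number k! divided by the product of the factorials of its
    multiplicities, and that product is the weight of each. In the induction the first index [i]
    contributes its multiplicity times k!, and the multiplicities add up to k + 1. *)
Lemma sum_perm_count (R : pzSemiRingType) (T : finType) k (S : seq T -> R) s :
  (forall I J : seq T, perm_eq I J -> S I = S J) ->
  \sum_(I : k.-tuple T) S I * (perm_count I s)%:R =
  if size s == k then S s *+ k`! else 0.
Proof.
elim: k S s => [|k IH] S s Sp.
  rewrite (big_pred1 (nil_tuple T)) => [|t]; last first.
    by apply/esym/eqP; rewrite (tuple0 t); apply: val_inj.
  by rewrite perm_count_nil size_eq0; case: eqP => [->|_]; rewrite ?mulr1 ?mulr0.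
rewrite (big_tuple_cons _ (fun I => S I * (perm_count I s)%:R)).
have E i : \sum_(I : k.-tuple T) S (i :: I) * (perm_count (i :: I) s)%:R =
    if size s == k.+1 then S s *+ (k`! * count_mem i s) else 0.
  under eq_bigr => I _ do
    rewrite perm_count_cons mulnC natrM mulrA mulr_natr.
  rewrite sumrMnl (IH (fun I => S (i :: I))); last first.
    by move=> I J IJ; apply: Sp; rewrite perm_cons.
  have [si|si] := boolP (i \in s); last first.
    by rewrite (count_memPn si) muln0 mulr0n; case: ifP.
  rewrite size_rem//; have s0 : (0 < size s)%N by case: (s) si.
  rewrite -[size s == _]/(size s == k.+1) -(prednK s0)/= eqSS.
  by case: ifP; rewrite ?mul0rn// -mulrnA (Sp _ _ (perm_to_rem si)).
rewrite (eq_bigr _ (fun i _ => E i)); case: ifP => [/eqP ss|_]; last by rewrite big1.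
rewrite sumrMnr -big_distrr/= factS mulnC; congr (_ *+ (_ * _)).
rewrite -ss -sum1_size big_mkcond/=.
under eq_bigr => i _ do rewrite -sum1_count.
rewrite (exchange_big_dep predT)//=.
by rewrite [RHS]big_mkcond/=; apply: eq_bigr => x _; rewrite (big_pred1 x).
Qed.

(** * Momentum derivatives *)

Lemma openX (S T : topologicalType) (A : set S) (B : set T) :
  open A -> open B -> open (A `*` B).
Proof.
move=> oA oB; rewrite openE => -[x y] [/= Ax By].
exists (A, B); last by move=> [].
by split=> /=; apply: open_nbhs_nbhs.
Qed.

Section Pairs.
Variables (R : realType) (U Q W : normedModType R).

(** The difference quotients coincide term by term. This links the phase-space derivatives of
    [dist_du] to the derivatives in u alone of [fib_du]. *)
Lemma derive_pairl (f : U * Q -> W) w u q :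
  'D_((w, 0) : U * Q) f (u, q) = 'D_w (fun u => f (u, q)) u.
Proof.
have E : (fun h : R => h^-1 *: ((f \o shift (u, q)) (h *: ((w, 0) : U * Q)) -
    f (u, q))) =
  (fun h => h^-1 *: (((fun u => f (u, q)) \o shift u) (h *: w) - f (u, q))).
  apply/funext => h; congr (_ *: (f _ - _)).
  by congr pair; rewrite /= scaler0 add0r.
by rewrite /derive E.
Qed.

Lemma derive_pairr (f : U * Q -> W) w u q :
  'D_((0, w) : U * Q) f (u, q) = 'D_w (fun q => f (u, q)) q.
Proof.
have E : (fun h : R => h^-1 *: ((f \o shift (u, q)) (h *: ((0, w) : U * Q)) -
    f (u, q))) =
  (fun h => h^-1 *: (((fun q => f (u, q)) \o shift q) (h *: w) - f (u, q))).
  apply/funext => h; congr (_ *: (f _ - _)).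
  by congr pair; rewrite /= scaler0 add0r.
by rewrite /derive E.
Qed.

End Pairs.

#[local] Opaque derive.

Section BigSums.
Variables (R : realType) (V : normedModType R).

Lemma derive_scale (c : R) (f : V -> R) x w : derivable f x w ->
  'D_w (fun p => c * f p) x = c * 'D_w f x.
Proof. by move=> df; exact: (deriveZ c df). Qed.

Lemma derive_lin (c : R) (f g : V -> R) x w :
  derivable f x w -> derivable g x w ->
  'D_w (fun p => f p + c * g p) x = 'D_w f x + c * 'D_w g x.
Proof.
move=> df dg.
have dcg : derivable (fun p => c * g p) x w := derivableZ (k := c) dg.
by apply: etrans (deriveD df dcg) _; rewrite derive_scale.
Qed.

Lemma differentiable_bigsum (I : Type) (r : seq I) (f : I -> V -> R) x :
  (forall i, differentiable (f i) x) ->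
  differentiable (fun x => \sum_(i <- r) f i x) x.
Proof.
move=> df; elim: r => [|i r IH].
  by under eq_fun do rewrite big_nil; exact: differentiable_cst.
under eq_fun do rewrite big_cons; exact: differentiableD.
Qed.

Lemma derive_bigsum (I : Type) (r : seq I) (f : I -> V -> R) w x :
  (forall i, differentiable (f i) x) ->
  'D_w (fun x => \sum_(i <- r) f i x) x = \sum_(i <- r) 'D_w (f i) x.
Proof.
move=> df; elim: r => [|i r IH].
  by under eq_fun do rewrite big_nil; rewrite big_nil derive_cst.
under eq_fun do rewrite big_cons; rewrite big_cons -IH deriveD//.
  by apply: diff_derivable; exact: df.
by apply: diff_derivable; exact: differentiable_bigsum.
Qed.

End BigSums.

Section Ansatz.
Variables (R : realType) (d : nat).
Notation vec := 'rV[R]_d.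
Notation spacetime := (spacetime_of R d).
Notation phase := (phase_of R d).

Definition row_coord (x : 'I_d) (u : vec) : R := u 0 x.

Lemma row_coord_is_linear x : linear (row_coord x).
Proof. by move=> a u w; rewrite /row_coord !mxE. Qed.
HB.instance Definition _ x :=
  GRing.isLinear.Build R vec R _ (row_coord x) (row_coord_is_linear x).

Lemma row_coord_continuous x : continuous (row_coord x).
Proof. exact: coord_continuous. Qed.

Definition momentum (p : phase) : vec := p.1.
Definition position (p : phase) : spacetime := p.2.

Lemma momentum_is_linear : linear momentum. Proof. by []. Qed.
Lemma position_is_linear : linear position. Proof. by []. Qed.
HB.instance Definition _ :=
  GRing.isLinear.Build R phase vec _ momentum momentum_is_linear.
HB.instance Definition _ :=
  GRing.isLinear.Build R phase spacetime _ position position_is_linear.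

Lemma momentum_continuous : continuous momentum.
Proof. by move=> p; exact: cvg_fst. Qed.
Lemma position_continuous : continuous position.
Proof. by move=> p; exact: cvg_snd. Qed.

Definition momentum_coord (x : 'I_d) (p : phase) : R := p.1 0 x.

Lemma momentum_coord_is_linear x : linear (momentum_coord x).
Proof. by move=> a p q; rewrite /momentum_coord !mxE. Qed.
HB.instance Definition _ x :=
  GRing.isLinear.Build R phase R _ (momentum_coord x)
    (momentum_coord_is_linear x).

Lemma momentum_coord_continuous x : continuous (momentum_coord x).
Proof.
move=> p; apply: (@continuous_comp _ _ _ momentum (row_coord x)).
  exact: momentum_continuous.
exact: row_coord_continuous.
Qed.

(** The left fold is dual to the right fold in the ansatz: the outermost distributional derivative
    is the first to reach the test function. *)
Definition du (I : seq 'I_d) (f : phase -> R) : phase -> R :=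
  foldl (fun f i => fun p => 'D_((e_ R i, 0) : phase) f p) f I.

Lemma du_cons i I f :
  du (i :: I) f = du I (fun p => 'D_((e_ R i, 0) : phase) f p).
Proof. by []. Qed.

Lemma du_rcons I j f :
  du (rcons I j) f = fun p => 'D_((e_ R j, 0) : phase) (du I f) p.
Proof. by rewrite /du foldl_rcons. Qed.

(** Momentum derivatives stay in the fibre over [q], so tensor components and moving centers may be
    frozen at [q]. *)
Lemma du_slice I (f g : phase -> R) q : (forall u, f (u, q) = g (u, q)) ->
  forall u, du I f (u, q) = du I g (u, q).
Proof.
elim: I f g => //= i I IH f g fg; apply: IH => u.
rewrite !derive_pairl (_ : (fun u => f (u, q)) = (fun u => g (u, q)))//.
exact/funext.
Qed.

Lemma du_zero I (p : phase) : du I (fun=> 0) p = 0.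
Proof.
elim: I p => [//|i I IH] p; rewrite du_cons -[RHS](IH p).
by congr du; apply/funext => x; exact: derive_cst.
Qed.

Section OpenDomain.
Variable Om : set phase.
Hypothesis oOm : open Om.

Lemma smooth_du I f : smooth Om f -> smooth Om (du I f).
Proof. by elim: I f => //= i I IH f sf; apply: IH; exact: smooth_derive. Qed.

Lemma du_open I f g : (forall p, Om p -> f p = g p) ->
  forall p, Om p -> du I f p = du I g p.
Proof.
elim: I f g => [|i I IH] f g fg p Op /=; first exact: fg.
by apply: IH => // x Ox; exact: derive_open fg Ox.
Qed.

Lemma du_lin I (c : R) f g : smooth Om f -> smooth Om g -> forall p, Om p ->
  du I (fun p => f p + c * g p) p = du I f p + c * du I g p.
Proof.
elim: I f g => //= i I IH f g sf sg p Op.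
rewrite -IH//; try exact: smooth_derive.
apply: du_open => // x Ox; apply: derive_lin.
  exact: smooth_derivable sf Ox.
exact: smooth_derivable sg Ox.
Qed.

Lemma du_sum (T : Type) (r : seq T) (c : T -> R) (g : T -> phase -> R) I p :
  (forall i, smooth Om (g i)) -> Om p ->
  du I (fun p => \sum_(i <- r) c i * g i p) p = \sum_(i <- r) c i * du I (g i) p.
Proof.
move=> sg Op; elim: r => [|i r IH].
  by under eq_fun do rewrite big_nil; rewrite big_nil du_zero.
under eq_fun do rewrite big_cons addrC; rewrite big_cons addrC -IH.
apply: du_lin => //; apply: smooth_sum => // j; exact: smooth_scale.
Qed.

Lemma du_scale I (c : R) f : smooth Om f -> forall p, Om p ->
  du I (fun p => c * f p) p = c * du I f p.
Proof.
elim: I f => //= i I IH f sf p Op.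
rewrite -IH//; last exact: smooth_derive.
apply: du_open => // x Ox; apply: derive_scale.
exact: smooth_derivable sf Ox.
Qed.

Lemma du_scale_position I (c : spacetime -> R) f : smooth Om f ->
  forall u q, Om (u, q) ->
  du I (fun p => c p.2 * f p) (u, q) = c q * du I f (u, q).
Proof.
move=> sf u q Oq; rewrite -du_scale//.
exact: (@du_slice I (fun p => c p.2 * f p) (fun p => c q * f p)).
Qed.

Lemma du_derive I w f : smooth Om f -> forall p, Om p ->
  du I (fun p => 'D_w f p) p = 'D_w (du I f) p.
Proof.
elim: I f => //= i I IH f sf p Op.
apply: etrans _ (IH _ (smooth_derive _ sf) p Op).
by apply: du_open Op => x Ox; exact: derive_swap oOm sf Ox.
Qed.

Lemma du_rem I i f : i \in I -> smooth Om f -> forall p, Om p ->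
  du I f p = du (i :: rem i I) f p.
Proof.
elim: I f => [//|j I IH] f; rewrite inE /=.
have [E _ _ p _|ji] := eqVneq j i; first by rewrite E.
move=> /= iI sf p Op.
apply: etrans (IH _ iI (smooth_derive _ sf) p Op) _; rewrite !du_cons.
by apply: du_open Op => x Ox; exact: derive_swap oOm sf Ox.
Qed.

(** Makes the Taylor coefficients a symmetric tensor, as [sum_perm_count] requires. *)
Lemma du_perm I J f : perm_eq I J -> smooth Om f -> forall p, Om p ->
  du I f p = du J f p.
Proof.
elim: I J f => [|i I IH] J f; first by rewrite perm_sym => /perm_nilP ->.
move=> iIJ sf p Op.
have iJ : i \in J by rewrite -(perm_mem iIJ) inE eqxx.
apply: etrans _ (esym (du_rem iJ sf Op)); apply: IH Op; last exact: smooth_derive.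
by rewrite -(perm_cons i) (perm_trans iIJ)// perm_to_rem.
Qed.

(* If the jet of [f] vanishes below order [size I], Leibniz' rule has a single
   surviving term. *)
Lemma du_mul_jet I (g f : phase -> R) p : smooth Om g -> smooth Om f -> Om p ->
  (forall J, (size J < size I)%N -> du J f p = 0) ->
  du I (fun p => g p * f p) p = g p * du I f p.
Proof.
elim: I g f => //= i I IH g f sg sf Op J0.
pose D (f : phase -> R) : phase -> R := fun p => 'D_((e_ R i, 0) : phase) f p.
have sDg : smooth Om (D g) by exact: smooth_derive.
have sDf : smooth Om (D f) by exact: smooth_derive.
have E1 : du I (fun p => g p * D f p) p = g p * du I (D f) p.
  by apply: IH => // J JI; exact: (J0 (i :: J)).
have E2 : du I (fun p => D g p * f p) p = D g p * du I f p.
  by apply: IH => // J JI; apply: J0; exact: ltnW.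
have f0 : du I f p = 0 by exact: J0.
rewrite f0 mulr0 in E2; rewrite -[RHS]addr0 -[in RHS](mulr0 1) -E1 -E2.
rewrite -du_lin//; try exact: smoothM.
apply: du_open Op => x Ox; rewrite mul1r.
rewrite deriveM; [|exact: smooth_derivable sg Ox|exact: smooth_derivable sf Ox].
by congr (_ + _); exact: mulrC.
Qed.

End OpenDomain.

Lemma derive_supp (K : set phase) (f : phase -> R) w : compact K ->
  (forall p, ~ K p -> f p = 0) -> forall p, ~ K p -> 'D_w f p = 0.
Proof.
move=> cK f0 p nKp; have oCK : open (~` K).
  by rewrite openC; apply: (compact_closed _ cK); exact: norm_hausdorff.
rewrite -(derive_cst (0 : R) p w).
by apply: (derive_open _ oCK).
Qed.

Lemma du_supp (K : set phase) I f : compact K -> (forall p, ~ K p -> f p = 0) ->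
  forall p, ~ K p -> du I f p = 0.
Proof.
move=> cK; elim: I f => [//|i I IH] f f0; rewrite du_cons.
by apply: IH; exact: derive_supp.
Qed.


End Ansatz.

(** * The ansatz *)

Section Pairing.
Variables (R : realType) (d : nat).
Notation vec := 'rV[R]_d.
Notation spacetime := (spacetime_of R d).
Notation phase := (phase_of R d).
Variables (D : set spacetime) (Om : set phase) (N : nat) (v : spacetime -> vec).
Variable C : tensor_fields R d.
Hypotheses (oD : open D) (oOm : open Om) (sv : smooth D v).
Hypothesis vOm : forall q, D q -> Om (v q, q).
Hypothesis OmD : forall p, Om p -> D p.2.
Hypothesis sC : forall a, (a <= N)%N ->
  forall I : a.-tuple 'I_d, smooth D (C I).

(* The pairing of the ansatz at [q] with the slice [f (., q)]; the signs of the
   ansatz cancel those of the distributional derivatives. *)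
Definition pairing (f : phase -> R) (q : spacetime) : R :=
  \sum_(a < N.+1) a`!%:R^-1 *
    \sum_(I : a.-tuple 'I_d) C I q * du I f (v q, q).

(* The [w]-derivative of [pairing f] with [f] frozen in [(x, t)]. *)
Definition pairing_deriv (w : spacetime) (f : phase -> R) (q : spacetime) : R :=
  \sum_(a < N.+1) a`!%:R^-1 *
    \sum_(I : a.-tuple 'I_d) ('D_w (C I) q * du I f (v q, q) +
      C I q * \sum_(j < d) 'D_w v q 0 j * du (rcons I j) f (v q, q)).

Lemma row_sum_dir (a : vec) :
  ((a, 0) : phase) = \sum_(j < d) a 0 j *: ((e_ R j, 0) : phase).
Proof.
apply: injective_projections.
  rewrite -[RHS]/(momentum _) linear_sum {1}[a]row_sum_delta/=.
  exact: eq_bigr.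
rewrite -[RHS]/(position _) linear_sum big1// => j _.
exact: scaler0.
Qed.

Lemma graph_differentiable (f : phase -> R) q : smooth Om f -> D q ->
  differentiable (fun q => f (v q, q)) q.
Proof.
move=> sf Dq.
have dg : differentiable (fun q => (v q, q)) q.
  apply: differentiable_pair; first exact: smooth_differentiable sv Dq.
  exact: (@ex_diff _ _ _ _ _ id).
by apply: (differentiable_comp dg); exact: smooth_differentiable sf (vOm Dq).
Qed.

(** The velocity of the graph is the motion of the center plus the horizontal direction [(0, w)].
    The first part is the dual form of the chain rule for delta(u - v). *)
Lemma graph_derive w (f : phase -> R) q : smooth Om f -> D q ->
  'D_w (fun q => f (v q, q)) q =
  \sum_(j < d) 'D_w v q 0 j * 'D_((e_ R j, 0) : phase) f (v q, q) +
  'D_((0, w) : phase) f (v q, q).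
Proof.
move=> sf Dq; have dv := smooth_differentiable sv Dq.
have did : differentiable (id : spacetime -> spacetime) q.
  exact: (@ex_diff _ _ _ _ _ id).
have dg : differentiable (fun q => (v q, q)) q by exact: differentiable_pair.
have df := smooth_differentiable sf (vOm Dq).
rewrite deriveE; last exact: (differentiable_comp dg df).
rewrite (diff_comp dg df)/= (diff_pair dv did)/=.
rewrite diff_val -(deriveE w dv).
have -> : (('D_w v q, w) : phase) =
    \sum_(j < d) 'D_w v q 0 j *: ((e_ R j, 0) : phase) + (0, w).
  transitivity ((('D_w v q, 0) : phase) + (0, w)).
    by congr pair; rewrite /= ?addr0 ?add0r.
  by rewrite row_sum_dir.
rewrite linearD linear_sum; congr (_ + _); last by rewrite (deriveE _ df).
by apply: eq_bigr => j _; rewrite linearZ/= (deriveE _ df).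
Qed.

Lemma smooth_jac w j : smooth D (fun q => 'D_w v q 0 j).
Proof.
have := @smooth_linear_comp _ _ _ _ _ (row_coord j) idfun
  (@row_coord_continuous R d j) _ D (fun q => 'D_w v q) oD.
by apply; [move=> x; exact: cvg_id|exact: smooth_derive].
Qed.

Lemma smooth_Ca (a : 'I_N.+1) (I : a.-tuple 'I_d) : smooth D (C I).
Proof. by apply: sC; rewrite -ltnS. Qed.

Lemma pairing_term_differentiable (a : 'I_N.+1) (I : a.-tuple 'I_d) f q :
  smooth Om f -> D q -> differentiable (fun q => C I q * du I f (v q, q)) q.
Proof.
move=> sf Dq; apply: differentiableM.
  exact: smooth_differentiable (@smooth_Ca a I) Dq.
by apply: graph_differentiable => //; exact: smooth_du.
Qed.

Lemma differentiable_scale (c : R) (h : spacetime -> R) q :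
  differentiable h q -> differentiable (fun q => c * h q) q.
Proof. by move=> dh; exact: (differentiableZ c dh). Qed.

Lemma pairing_differentiable f q : smooth Om f -> D q ->
  differentiable (pairing f) q.
Proof.
move=> sf Dq; apply: differentiable_bigsum => a.
apply: differentiable_scale; apply: differentiable_bigsum => I.
exact: pairing_term_differentiable.
Qed.

(** The product rule that moves an (x, t)-derivative off the test function: the chain rule along the
    graph splits each term, and the symmetry of derivatives ([du_derive]) puts the horizontal one
    back onto [f]. *)
Lemma pairing_derive w f q : smooth Om f -> D q ->
  'D_w (pairing f) q =
  pairing (fun p => 'D_((0, w) : phase) f p) q + pairing_deriv w f q.
Proof.
move=> sf Dq; rewrite /pairing derive_bigsum; last first.
  move=> a; apply: differentiable_scale; apply: differentiable_bigsum => I.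
  exact: pairing_term_differentiable.
rewrite -big_split; apply: eq_bigr => a _.
have dt (I : a.-tuple 'I_d) := pairing_term_differentiable I sf Dq.
rewrite derive_scale; last first.
  by apply: diff_derivable; exact: differentiable_bigsum.
rewrite [RHS]/= -mulrDr; congr (_ * _); rewrite derive_bigsum// -big_split.
apply: eq_bigr => I _; rewrite [RHS]/=.
have sdf : smooth Om (du I f) by exact: smooth_du.
rewrite deriveM; last 2 first.
- by apply: diff_derivable; exact: smooth_differentiable (@smooth_Ca a I) Dq.
- by apply: diff_derivable; exact: graph_differentiable.
rewrite graph_derive// (du_derive oOm _ _ sf (vOm Dq)).
under [in RHS]eq_bigr => j _ do rewrite du_rcons.
rewrite -[X in X + _ = _]/(_ * _) -[X in _ + X = _]/(_ * _).
by rewrite mulrDr (mulrC (du I f (v q, q))); ring.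
Qed.

Lemma pairing_deriv_differentiable w f q : smooth Om f -> D q ->
  differentiable (pairing_deriv w f) q.
Proof.
move=> sf Dq; apply: differentiable_bigsum => a.
apply: differentiable_scale; apply: differentiable_bigsum => I.
apply: differentiableD; apply: differentiableM.
- exact: smooth_differentiable (smooth_derive w (@smooth_Ca a I)) Dq.
- by apply: graph_differentiable => //; exact: smooth_du.
- exact: smooth_differentiable (@smooth_Ca a I) Dq.
- apply: differentiable_bigsum => j; apply: differentiableM.
    exact: smooth_differentiable (smooth_jac w j) Dq.
  by apply: graph_differentiable => //; exact: smooth_du.
Qed.

Lemma pairing_derive_continuous w f q : smooth Om f -> D q ->
  {for q, continuous (fun q => 'D_w (pairing f) q)}.
Proof.
move=> sf Dq; apply: differentiable_continuous.
have E r : D r -> pairing (fun p => 'D_((0, w) : phase) f p) r +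
    pairing_deriv w f r = 'D_w (pairing f) r.
  by move=> Dr; rewrite pairing_derive.
apply: near_eq_differentiable (open_near oD Dq E) _.
apply: differentiableD; last exact: pairing_deriv_differentiable.
by apply: pairing_differentiable => //; exact: smooth_derive.
Qed.

Lemma pairing_lin (c : R) f g q : smooth Om f -> smooth Om g -> D q ->
  pairing (fun p => f p + c * g p) q = pairing f q + c * pairing g q.
Proof.
move=> sf sg Dq; rewrite /pairing big_distrr -big_split; apply: eq_bigr => a _.
rewrite [in RHS]/= mulrCA -mulrDr; congr (_ * _).
rewrite big_distrr -big_split; apply: eq_bigr => I _.
by rewrite [in RHS]/= (du_lin oOm _ _ sf sg (vOm Dq)) mulrDr mulrCA.
Qed.

Lemma pairing_deriv_lin w (c : R) f g q : smooth Om f -> smooth Om g -> D q ->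
  pairing_deriv w (fun p => f p + c * g p) q =
  pairing_deriv w f q + c * pairing_deriv w g q.
Proof.
move=> sf sg Dq; rewrite /pairing_deriv big_distrr -big_split.
apply: eq_bigr => a _.
rewrite [in RHS]/= mulrCA -mulrDr; congr (_ * _).
rewrite big_distrr -big_split; apply: eq_bigr => I _.
rewrite [in RHS]/= (du_lin oOm _ _ sf sg (vOm Dq)).
have -> : \sum_(j < d) 'D_w v q 0 j *
      du (rcons I j) (fun p => f p + c * g p) (v q, q) =
    \sum_(j < d) 'D_w v q 0 j * du (rcons I j) f (v q, q) +
    c * \sum_(j < d) 'D_w v q 0 j * du (rcons I j) g (v q, q).
  rewrite big_distrr -big_split; apply: eq_bigr => j _.
  by rewrite [in RHS]/= (du_lin oOm _ _ sf sg (vOm Dq)) mulrDr mulrCA.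
by ring.
Qed.

Lemma pairing_ext f g q : (forall p, Om p -> f p = g p) -> D q ->
  pairing f q = pairing g q.
Proof.
move=> fg Dq; apply: eq_bigr => a _; congr (_ * _); apply: eq_bigr => I _.
by congr (_ * _); exact: (du_open oOm _ fg (vOm Dq)).
Qed.

Lemma pairing_deriv_slice w f g q : (forall u, f (u, q) = g (u, q)) ->
  pairing_deriv w f q = pairing_deriv w g q.
Proof.
move=> fg; apply: eq_bigr => a _; congr (_ * _); apply: eq_bigr => I _.
congr (_ + _); first by rewrite (du_slice _ fg).
by congr (_ * _); apply: eq_bigr => j _; rewrite (du_slice _ fg).
Qed.

Lemma foldr_fib_du I f q :
  foldr (@fib_du R d) (fib_delta v) I q (fun u => f (u, q)) =
  (-1) ^+ size I * du I f (v q, q).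
Proof.
elim: I f => [|i I IH] f; first by rewrite mul1r.
transitivity (- foldr (@fib_du R d) (fib_delta v) I q
    (fun u => 'D_(e_ R i) (fun u => f (u, q)) u)); first by [].
pose g : phase -> R := fun p => 'D_((e_ R i, 0) : phase) f p.
have -> : (fun u => 'D_(e_ R i) (fun u => f (u, q)) u) = (fun u => g (u, q)).
  by apply/funext => u; rewrite -derive_pairl.
by rewrite IH exprS mulN1r mulNr.
Qed.

Lemma sign_fact a : (-1) ^+ a / a`!%:R * (-1) ^+ a = a`!%:R^-1 :> R.
Proof. by rewrite mulrAC -exprD addnn -mul2n exprM sqrrN !expr1n mul1r. Qed.

Lemma fact_neq0 a : (a`!%:R : R) != 0.
Proof. by rewrite pnatr_eq0 -lt0n fact_gt0. Qed.

(** Expresses the moment hierarchy through [pairing]; each of the [a] transposed derivatives gives a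
    sign, and [sign_fact] cancels them. *)
Lemma fib_ansatzE f q : smooth Om f -> D q ->
  fib_ansatz N v C q (fun u => f (u, q)) = pairing f q.
Proof.
move=> sf Dq; apply: eq_bigr => a _; rewrite -[in RHS]sign_fact -[RHS]mulrA.
congr (_ * _); rewrite big_distrr; apply: eq_bigr => I _.
rewrite /fib_mul (foldr_fib_du I (fun p => C I p.2 * f p)) size_tuple.
by congr (_ * _); exact: (du_scale_position oOm I (C I) sf (vOm Dq)).
Qed.

Lemma foldr_dist_du I f :
  foldr (@dist_du R d) (dist_delta D v) I f =
  (-1) ^+ size I * spacetime_integral D (fun q => du I f (v q, q)).
Proof.
elim: I f => [|i I IH] f; first by rewrite mul1r.
pose g : phase -> R := fun p => 'D_((e_ R i, 0) : phase) f p.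
transitivity (- foldr (@dist_du R d) (dist_delta D v) I g); first by [].
by rewrite IH exprS mulN1r mulNr.
Qed.

Hypothesis symC : forall a, (a <= N)%N -> symmetric_on D (@C a).
Variables (G F : phase -> vec) (Rc : phase -> R).
Hypotheses (sG : smooth Om G) (sF : smooth Om F) (sRc : smooth Om Rc).
Hypothesis moments : moment_hierarchy D N v C G F Rc.
Hypothesis center : center_equation D v G F.

Lemma smooth_coord (f : phase -> vec) i :
  smooth Om f -> smooth Om (fun p => f p 0 i).
Proof.
move=> sf; have := @smooth_linear_comp _ _ _ _ _ (row_coord i) idfun
  (@row_coord_continuous R d i) _ Om f oOm.
by apply => // x; exact: cvg_id.
Qed.

(* The space-time density of the weak residual once the derivatives falling on
   the test function have been integrated by parts. *)
Definition residual (f : phase -> R) (q : spacetime) : R :=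
  pairing_deriv (dir_t R d) f q +
  \sum_(i < d) (pairing_deriv (dir_x R i) (fun p => G p 0 i * f p) q +
    pairing (fun p => 'D_((0, dir_x R i) : phase) (fun p => G p 0 i) p * f p) q) -
  \sum_(i < d) pairing (fun p => F p 0 i * 'D_((e_ R i, 0) : phase) f p) q +
  pairing (fun p => Rc p * f p) q.

Lemma pairing_mul_lin (h : phase -> R) (c : R) f g q :
  smooth Om h -> smooth Om f -> smooth Om g -> D q ->
  pairing (fun p => h p * (f p + c * g p)) q =
  pairing (fun p => h p * f p) q + c * pairing (fun p => h p * g p) q.
Proof.
move=> sh sf sg Dq; rewrite -pairing_lin//; try exact: smoothM.
by apply: pairing_ext => // p _; rewrite mulrDr mulrCA.
Qed.

Lemma residual_lin (c : R) f g q : smooth Om f -> smooth Om g -> D q ->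
  residual (fun p => f p + c * g p) q = residual f q + c * residual g q.
Proof.
move=> sf sg Dq; rewrite /residual.
have -> : \sum_(i < d)
    (pairing_deriv (dir_x R i) (fun p => G p 0 i * (f p + c * g p)) q +
    pairing (fun p => 'D_((0, dir_x R i) : phase) (fun p => G p 0 i) p *
      (f p + c * g p)) q) =
  \sum_(i < d) (pairing_deriv (dir_x R i) (fun p => G p 0 i * f p) q +
    pairing (fun p => 'D_((0, dir_x R i) : phase) (fun p => G p 0 i) p * f p) q) +
  c * \sum_(i < d) (pairing_deriv (dir_x R i) (fun p => G p 0 i * g p) q +
    pairing (fun p => 'D_((0, dir_x R i) : phase) (fun p => G p 0 i) p * g p) q).
  rewrite big_distrr -big_split; apply: eq_bigr => i _.
  have sGi := smooth_coord i sG.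
  rewrite pairing_mul_lin//; last exact: smooth_derive.
  rewrite (_ : (fun p => G p 0 i * (f p + c * g p)) =
    (fun p => G p 0 i * f p + c * (G p 0 i * g p))); last first.
    by apply/funext => p; rewrite mulrDr mulrCA.
  rewrite pairing_deriv_lin//; try exact: smoothM.
  by rewrite [RHS]/=; ring.
have -> : \sum_(i < d) pairing (fun p => F p 0 i *
      'D_((e_ R i, 0) : phase) (fun p => f p + c * g p) p) q =
  \sum_(i < d) pairing (fun p => F p 0 i * 'D_((e_ R i, 0) : phase) f p) q +
  c * \sum_(i < d) pairing (fun p => F p 0 i * 'D_((e_ R i, 0) : phase) g p) q.
  rewrite big_distrr -big_split; apply: eq_bigr => i _.
  have sFi := smooth_coord i sF.
  rewrite [RHS]/= -pairing_mul_lin//; try exact: smooth_derive.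
  apply: pairing_ext Dq => p Op; congr (_ * _); apply: derive_lin.
    exact: smooth_derivable sf Op.
  exact: smooth_derivable sg Op.
rewrite pairing_deriv_lin// pairing_mul_lin//.
by ring.
Qed.

(** * Test functions with vanishing N-jet at the center *)

Section Jets.
Variables (f : phase -> R) (q : spacetime).
Hypotheses (sf : smooth Om f) (Dq : D q).
Hypothesis f0 : forall I, (size I <= N)%N -> du I f (v q, q) = 0.

Lemma pairing_jet0 (h : phase -> R) : smooth Om h ->
  pairing (fun p => h p * f p) q = 0.
Proof.
move=> sh; rewrite /pairing big1// => a _; rewrite big1 ?mulr0// => I _.
have sI : (size I <= N)%N by rewrite size_tuple -ltnS.
rewrite (du_mul_jet oOm sh sf (vOm Dq)) ?f0 ?mulr0// => J JI.
by apply: f0; exact: leq_trans (ltnW JI) sI.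
Qed.

(** A first derivative of [f] still vanishes to order N - 1, just enough for [du_mul_jet] at every
    rank up to N. *)
Lemma pairing_jet1 (h : phase -> R) j : smooth Om h ->
  pairing (fun p => h p * 'D_((e_ R j, 0) : phase) f p) q =
  h (v q, q) * pairing (fun p => 'D_((e_ R j, 0) : phase) f p) q.
Proof.
move=> sh; rewrite /pairing big_distrr; apply: eq_bigr => a _.
rewrite [RHS]/= mulrCA; congr (_ * _); rewrite big_distrr; apply: eq_bigr => I _.
rewrite [RHS]/= mulrCA; congr (_ * _).
apply: (du_mul_jet oOm sh (smooth_derive _ sf) (vOm Dq)) => J JI.
rewrite -du_cons; apply: f0; apply: leq_trans JI _.
by rewrite size_tuple -ltnS.
Qed.

Lemma pairing_jet_derive (h : phase -> R) j : smooth Om h ->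
  pairing (fun p => 'D_((e_ R j, 0) : phase) (fun p => h p * f p) p) q =
  h (v q, q) * pairing (fun p => 'D_((e_ R j, 0) : phase) f p) q.
Proof.
move=> sh; rewrite -pairing_jet1//.
have sDf : smooth Om (fun p => 'D_((e_ R j, 0) : phase) f p).
  exact: smooth_derive.
have sDh : smooth Om (fun p => 'D_((e_ R j, 0) : phase) h p).
  exact: smooth_derive.
rewrite -[RHS]addr0 -[in RHS](mulr0 1) -(pairing_jet0 sDh).
rewrite -pairing_lin//; try exact: smoothM.
apply: pairing_ext Dq => p Op; rewrite mul1r.
rewrite deriveM; [|exact: smooth_derivable sh Op|exact: smooth_derivable sf Op].
by congr (_ + _); exact: mulrC.
Qed.

(** The terms with a differentiated tensor see at most N derivatives of [f] and vanish; only the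
    motion of the center, one order higher, survives. *)
Lemma pairing_deriv_jet w (h : phase -> R) : smooth Om h ->
  pairing_deriv w (fun p => h p * f p) q =
  h (v q, q) * \sum_(j < d) 'D_w v q 0 j *
    pairing (fun p => 'D_((e_ R j, 0) : phase) f p) q.
Proof.
move=> sh; rewrite big_distrr.
have shf : smooth Om (fun p => h p * f p) by exact: smoothM.
transitivity (\sum_(j < d) 'D_w v q 0 j *
    pairing (fun p => 'D_((e_ R j, 0) : phase) (fun p => h p * f p) p) q).
  rewrite /pairing_deriv.
  under [RHS]eq_bigr => j _ do rewrite /pairing big_distrr.
  rewrite exchange_big; apply: eq_bigr => a _.
  under [RHS]eq_bigr => j _ do rewrite /= mulrCA big_distrr.
  rewrite -big_distrr; congr (_ * _); rewrite exchange_big; apply: eq_bigr => I _.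
  have sI : (size I <= N)%N by rewrite size_tuple -ltnS.
  rewrite (du_mul_jet oOm sh sf (vOm Dq)) ?f0 ?mulr0 ?add0r//; last first.
    by move=> J JI; apply: f0; exact: leq_trans (ltnW JI) sI.
  rewrite big_distrr; apply: eq_bigr => j _.
  by rewrite [LHS]/= [RHS]/= mulrCA (du_derive oOm _ _ shf (vOm Dq)) du_rcons.
apply: eq_bigr => j _; rewrite pairing_jet_derive//.
by rewrite [RHS]/= mulrCA.
Qed.

(** With [P j] the pairing with the [j]-th derivative of [f], what is left is the sum over [j] of
    [P j] times d_t v_j + G . grad v_j - F_j at the center. *)
Lemma residual_jet : residual f q = 0.
Proof.
rewrite /residual pairing_jet0// addr0.
pose P j := pairing (fun p => 'D_((e_ R j, 0) : phase) f p) q.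
have -> : pairing_deriv (dir_t R d) f q =
    \sum_(j < d) 'D_(dir_t R d) v q 0 j * P j.
  have := @pairing_deriv_jet (dir_t R d) (fun=> 1) (smooth_cst (1 : R)).
  by rewrite mul1r => <-; congr pairing_deriv; apply/funext => p; rewrite mul1r.
have -> : \sum_(i < d) (pairing_deriv (dir_x R i) (fun p => G p 0 i * f p) q +
    pairing (fun p => 'D_((0, dir_x R i) : phase) (fun p => G p 0 i) p * f p) q) =
  \sum_(j < d) \sum_(i < d) G (v q, q) 0 i * 'D_(dir_x R i) v q 0 j * P j.
  rewrite exchange_big; apply: eq_bigr => i _.
  have sGi := smooth_coord i sG.
  rewrite pairing_jet0 ?addr0; last exact: smooth_derive.
  rewrite pairing_deriv_jet// big_distrr; apply: eq_bigr => j _.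
  by rewrite [LHS]/= mulrA.
have -> : \sum_(i < d) pairing
    (fun p => F p 0 i * 'D_((e_ R i, 0) : phase) f p) q =
  \sum_(j < d) F (v q, q) 0 j * P j.
  by apply: eq_bigr => j _; apply: pairing_jet1; exact: smooth_coord.
rewrite -big_split -sumrB big1// => j _.
rewrite [LHS]/= (center Dq j) -big_distrl /=.
set S := \sum_(i < d) _; set b := F _ _ _; set c := P j.
by rewrite mulrDl mulNr; ring.
Qed.

End Jets.

(** * Moments of the ansatz and Taylor monomials *)

Section Monomials.

Definition vmono (a : vec) (s : seq 'I_d) (u : vec) : R :=
  \prod_(x <- s) (u 0 x - a 0 x).

Lemma smooth_vmono (a : vec) s : smooth setT (vmono a s).
Proof.
apply: smooth_prod; first exact: openT.
move=> x; apply: smoothB; [exact: openT| |exact: smooth_cst].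
exact: (smooth_linear (L := row_coord x) (@row_coord_continuous R d x)).
Qed.

(** The multiplicity on both sides covers [i] outside [s], where [rem] removes nothing. *)
Lemma vmono_rem (a : vec) s i (u : vec) :
  (count_mem i s)%:R * ((u 0 i - a 0 i) * vmono a (rem i s) u) =
  (count_mem i s)%:R * vmono a s u.
Proof.
have [si|/count_memPn ->] := boolP (i \in s); last by rewrite !mul0r.
by rewrite [in RHS]/vmono (perm_big _ (perm_to_rem si)) big_cons.
Qed.

Lemma derive_vmono (a : vec) s i (u : vec) :
  'D_(e_ R i) (vmono a s) u = (count_mem i s)%:R * vmono a (rem i s) u.
Proof.
elim: s => [|x s IH].
  rewrite mul0r -(derive_cst (1 : R) u (e_ R i)); congr ('D_ _ _ _).
  by apply/funext => w; rewrite /vmono big_nil.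
rewrite (_ : vmono a (x :: s) = fun u => (row_coord x u - a 0 x) * vmono a s u).
  have dx : is_derive u (e_ R i) (fun u => row_coord x u - a 0 x) (i == x)%:R.
    have dL : differentiable (row_coord x) u.
      by apply: linear_differentiable; exact: row_coord_continuous.
    have dc : derivable (fun=> a 0 x : R) u (e_ R i) by exact: derivable_cst.
    apply: DeriveDef; first by apply: derivableB => //; exact: diff_derivable.
    rewrite deriveB//; last exact: diff_derivable.
    rewrite derive_cst subr0 (deriveE _ dL) diff_lin; last first.
      exact: row_coord_continuous.
    by change (e_ R i 0 x = (i == x)%:R); rewrite /e_ mxE eqxx eq_sym.
  rewrite deriveM; last 2 first.
  - exact: (@ex_derive _ _ _ _ _ _ _ dx).
  - apply: smooth_derivable (smooth_vmono a s) _; exact: I.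
  rewrite (@derive_val _ _ _ _ _ _ _ dx) IH.
  rewrite -[X in X + _ = _]/(_ * _) -[X in _ + X = _]/(_ * _) /= /row_coord.
  have [<-|xi] := eqVneq x i.
    by rewrite mulrCA vmono_rem natrD mulrDl mul1r mulr1 addrC.
  by rewrite /= mulr0 addr0 add0n mulrCA /vmono big_cons.
by apply/funext => w; rewrite /vmono big_cons.
Qed.

(* The monomial in u - c(x, t) whose exponents are the multiplicities in [s]:
   [c := v] gives the moments, constant [c] the Taylor monomials. *)
Definition mono (c : spacetime -> vec) (s : seq 'I_d) (p : phase) : R :=
  vmono (c p.2) s p.1.

Lemma smooth_sub (A B : set phase) (g : phase -> R) :
  A `<=` B -> smooth B g -> smooth A g.
Proof. by move=> AB sg ws p /AB; exact: sg. Qed.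

Lemma smooth_mono (c : spacetime -> vec) s : smooth D c -> smooth Om (mono c s).
Proof.
move=> sc.
apply: (smooth_prod oOm s (f := fun x p => momentum_coord x p -
  row_coord x (c (position p)))) => x.
have H1 : smooth Om (@momentum_coord R d x).
  by apply: smooth_linear; exact: momentum_coord_continuous.
have H2 : smooth (@position R d @^-1` D) (fun p => row_coord x (c (position p))).
  apply: smooth_linear_comp => //; first exact: row_coord_continuous.
  exact: position_continuous.
exact: (smoothB oOm H1 (smooth_sub (fun p Op => OmD Op) H2)).
Qed.

Lemma derive_mono (c : spacetime -> vec) s i (p : phase) :
  'D_((e_ R i, 0) : phase) (mono c s) p =
  (count_mem i s)%:R * mono c (rem i s) p.
Proof.
by case: p => u q; rewrite derive_pairl; exact: (derive_vmono (c q) s i u).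
Qed.

(** At the center a monomial survives only once each factor has been differentiated away exactly.
    Only the value of [c] at [q] enters, so moving and frozen centers give the same number. *)
Lemma du_mono I c s q : D q -> c q = v q ->
  du I (mono c s) (v q, q) = (perm_count I s)%:R.
Proof.
move=> Dq cq.
rewrite (@du_slice _ _ I (mono c s) (mono (fun=> v q) s)); last first.
  by move=> u; rewrite /mono cq.
elim: I s => [|i I IH] s.
  rewrite perm_count_nil /du /mono /vmono /=; case: s => [|x s].
    by rewrite big_nil eqxx.
  by rewrite big_cons subrr mul0r.
rewrite du_cons (_ : (fun p => _) =
    (fun p => (count_mem i s)%:R * mono (fun=> v q) (rem i s) p)); last first.
  by apply/funext => p; exact: derive_mono.
have sm : smooth Om (mono (fun=> v q) (rem i s)).
  by apply: smooth_mono; exact: smooth_cst.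
by rewrite (du_scale oOm _ _ sm (vOm Dq)) IH perm_count_cons natrM.
Qed.

Lemma sum_tensor_perm_count a (S : a.-tuple 'I_d -> R) (s : seq 'I_d) :
  (forall I J : a.-tuple 'I_d, perm_eq I J -> S I = S J) ->
  \sum_(I : a.-tuple 'I_d) S I * (perm_count I s)%:R =
  if insub s is Some t then S t *+ a`! else 0.
Proof.
(* Extension by zero to lists of other lengths, because [sum_perm_count] takes functions of
   lists. *)
move=> Sp; pose S' (J : seq 'I_d) := oapp S 0 (insub J).
have E (I : a.-tuple 'I_d) : S I = S' I by rewrite /S' valK.
under eq_bigr do rewrite E.
rewrite sum_perm_count.
  by rewrite /S'; case: insubP => [t sz _|/negPf sz]; rewrite sz.
move=> I J IJ; rewrite /S'; case: insubP => [t It tI|nI].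
  case: insubP => [t' Jt' tJ|]; last by rewrite -(perm_size IJ) It.
  by apply: Sp; rewrite tI tJ.
by case: insubP => // t'; rewrite -(perm_size IJ) (negPf nI).
Qed.

(** The centered moments of the ansatz are its own coefficients: by symmetry the rank-k tensor is
    counted k! times, which cancels 1/k!, and other ranks give zero. *)
Lemma pairing_mono k (s : k.-tuple 'I_d) q : (k <= N)%N -> D q ->
  pairing (mono v s) q = C s q.
Proof.
move=> kN Dq; rewrite /pairing.
have E (a : 'I_N.+1) : a`!%:R^-1 *
    (\sum_(I : a.-tuple 'I_d) C I q * du I (mono v s) (v q, q)) =
    if insub (tval s) is Some t then C (t : a.-tuple 'I_d) q else 0.
  under eq_bigr => I _ do rewrite du_mono//.
  rewrite (@sum_tensor_perm_count a (fun I => C I q)); last first.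
    by move=> I J IJ; apply: symC Dq => //; rewrite -ltnS.
  case: insubP => [t _ _|_]; last by rewrite mulr0.
  by rewrite -[C t q *+ _]mulr_natr mulrCA (mulVf (fact_neq0 a)) mulr1.
rewrite (eq_bigr _ (fun a _ => E a)).
rewrite (bigD1 (Ordinal (kN : (k < N.+1)%N)))//= valK big1 ?addr0// => a ak.
case: insubP => // t /=; rewrite size_tuple => /eqP ka.
by case/eqP: ak; apply: val_inj.
Qed.

Lemma centered_powerE k (s : k.-tuple 'I_d) r u q :
  centered_power v s r u = mono (fun=> v r) s (u, q).
Proof.
rewrite /centered_power /mono /vmono big_tuple.
by apply: eq_bigr => l _; rewrite !mxE.
Qed.

Lemma residual_mono k (s : k.-tuple 'I_d) q : (k <= N)%N -> D q ->
  residual (mono (fun=> v q) s) q = 0.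
Proof.
move=> kN Dq; set m := mono _ s.
have sm : smooth Om m by apply: smooth_mono; exact: smooth_cst.
have smv : smooth Om (mono v s) by exact: smooth_mono.
have Em : centered_power v s q = fun u => m (u, q).
  by apply/funext => u; exact: centered_powerE.
have E1 : 'D_(dir_t R d) (C s) q =
    pairing (fun p => 'D_((0, dir_t R d) : phase) (mono v s) p) q +
    pairing_deriv (dir_t R d) m q.
  transitivity ('D_(dir_t R d) (pairing (mono v s)) q).
    by apply: derive_open Dq => // r Dr; rewrite pairing_mono.
  by rewrite pairing_derive//; congr (_ + _); exact: pairing_deriv_slice.
have E2 : fib_ansatz N v C q
    (fun u => 'D_(dir_t R d) (fun r => centered_power v s r u) q) =
    pairing (fun p => 'D_((0, dir_t R d) : phase) (mono v s) p) q.
  rewrite -fib_ansatzE//; last exact: smooth_derive.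
  congr fib_ansatz; apply/funext => u; rewrite derive_pairr.
  by congr ('D_ _ _ _); apply/funext => r; rewrite (centered_powerE _ _ _ r).
have E3 : fib_div_x G (fib_ansatz N v C) q (centered_power v s q) =
  \sum_(i < d) (pairing_deriv (dir_x R i) (fun p => G p 0 i * m p) q +
    pairing (fun p => 'D_((0, dir_x R i) : phase) (fun p => G p 0 i) p * m p) q).
  apply: eq_bigr => i _; have sGi := smooth_coord i sG.
  have sGm : smooth Om (fun p => G p 0 i * m p) by exact: smoothM.
  transitivity ('D_(dir_x R i) (pairing (fun p => G p 0 i * m p)) q).
    apply: derive_open Dq => // r Dr.
    by rewrite -fib_ansatzE// /fib_mul Em.
  rewrite pairing_derive// addrC; congr (_ + _).
  apply: pairing_ext Dq => p Op.
  rewrite deriveM; [|exact: smooth_derivable sGi Op|exact: smooth_derivable sm Op].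
  have -> : 'D_((0, dir_x R i) : phase) m p = 0.
    by case: (p) => u r; rewrite derive_pairr; exact: (derive_cst (vmono (v q) s u)).
  by rewrite scaler0 add0r; exact: mulrC.
have E4 : fib_div_u F (fib_ansatz N v C) q (centered_power v s q) =
  - \sum_(i < d) pairing (fun p => F p 0 i * 'D_((e_ R i, 0) : phase) m p) q.
  rewrite -sumrN; apply: eq_bigr => i _; congr (- _).
  have sFi := smooth_coord i sF.
  rewrite -fib_ansatzE//; last by apply: smoothM => //; exact: smooth_derive.
  congr fib_ansatz; apply/funext => u; congr (_ * _).
  by rewrite derive_pairl Em.
have E5 : fib_mul Rc (fib_ansatz N v C) q (centered_power v s q) =
    pairing (fun p => Rc p * m p) q.
  by rewrite -fib_ansatzE//; [rewrite Em|exact: smoothM].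
have := moments kN s Dq; rewrite E1 E2 E3 E4 E5 /residual.
set a := pairing _ _; set b := pairing_deriv _ m _; set x := \sum_(i < d) _.
set u := \sum_(i < d) _; set r := pairing _ _ => E.
have -> : b = a - x + u - r - a by rewrite -(addKr a b) E opprK addrC.
by ring.
Qed.

End Monomials.


Lemma residual_sum0 (T : Type) (r : seq T) (c : T -> R) (g : T -> phase -> R) q :
  D q -> (forall i, smooth Om (g i)) -> (forall i, residual (g i) q = 0) ->
  residual (fun p => \sum_(i <- r) c i * g i p) q = 0.
Proof.
move=> Dq sg g0; elim: r => [|i r IH].
  (* The zero function has vanishing jet, which settles the empty sum. *)
  under eq_fun do rewrite big_nil; apply: residual_jet Dq _ => [|I _].
    exact: smooth_cst.
  exact: du_zero.
under eq_fun do rewrite big_cons addrC.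
rewrite residual_lin ?IH ?g0 ?mulr0 ?addr0//.
by apply: smooth_sum => // j; exact: smooth_scale.
Qed.

(* Only the [N]-jet of [f] at [v q] matters, so [f] may be replaced by its
   Taylor polynomial there, to which the moment equations apply. *)
Lemma residual_eq0 f q : smooth Om f -> D q -> residual f q = 0.
Proof.
move=> sf Dq; have Oq := vOm Dq.
have sm (s : seq 'I_d) : smooth Om (mono (fun=> v q) s).
  by apply: smooth_mono; exact: smooth_cst.
pose T (k : 'I_N.+1) p := \sum_(s : k.-tuple 'I_d)
  du s f (v q, q) * mono (fun=> v q) s p.
have sT k : smooth Om (T k).
  by apply: smooth_sum => // s; apply: smooth_scale => //; exact: sm.
have rT k : residual (T k) q = 0.
  apply: residual_sum0 => // s; apply: residual_mono => //.
  by rewrite -ltnS.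
(* [P] is minus the Taylor polynomial in u of degree N at [v q]; the sign is built in so that
   [f + 1 * P] has vanishing N-jet and the shape of [residual_lin]. *)
pose P p := \sum_(k < N.+1) (- (k`!%:R)^-1) * T k p.
have sP : smooth Om P.
  by apply: smooth_sum => // k; exact: smooth_scale.
have rP : residual P q = 0 by exact: residual_sum0.
have : residual (fun p => f p + 1 * P p) q = 0; last first.
  by rewrite residual_lin// rP mulr0 addr0.
apply: (residual_jet _ Dq) => [|I IN].
  by apply: smoothD => //; exact: smooth_scale.
rewrite (du_lin oOm _ _ sf sP Oq) mul1r (du_sum oOm _ _ _ sT Oq).
have TE (k : 'I_N.+1) : du I (T k) (v q, q) =
    if size I == k then du I f (v q, q) *+ k`! else 0.
  rewrite /T (du_sum oOm _ _ _ (fun s : k.-tuple 'I_d => sm s) Oq).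
  have sE (s : k.-tuple 'I_d) : du s f (v q, q) *
      du I (mono (fun=> v q) s) (v q, q) = du s f (v q, q) * (perm_count s I)%:R.
    (* The sum runs over the index of the monomial; symmetry of [perm_count] moves it to the slot
       summed in [sum_perm_count]. *)
    by rewrite (@du_mono I (fun=> v q) s q Dq erefl) perm_count_sym.
  rewrite (eq_bigr _ (fun s _ => sE s)).
  rewrite (@sum_perm_count _ _ k (fun J => du J f (v q, q)))//.
  by move=> J J' JJ'; exact: (du_perm oOm JJ' sf Oq).
under eq_bigr => k _ do rewrite TE.
rewrite (bigD1 (Ordinal (IN : (size I < N.+1)%N)))//= eqxx big1; last first.
  move=> k kI; case: eqP => [E|]; last by rewrite mulr0.
  by case/eqP: kI; apply: val_inj.
rewrite addr0 mulNr -[X in _ - _ * X]mulr_natr mulrCA.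
by rewrite (mulVf (fact_neq0 (size I))) mulr1 subrr.
Qed.

(** * Integration by parts against a test function *)

Variable K : set phase.
Hypotheses (cK : compact K) (KOm : K `<=` Om).

Lemma compact_position : compact (@position R d @` K).
Proof.
apply: continuous_compact cK; apply: continuous_subspaceT.
exact: position_continuous.
Qed.

Lemma position_sub : @position R d @` K `<=` D.
Proof. by move=> _ [p Kp <-]; apply: OmD; exact: KOm. Qed.

Lemma du_supp_position I f : (forall p, ~ K p -> f p = 0) ->
  forall q, ~ (@position R d @` K) q -> du I f (v q, q) = 0.
Proof.
move=> f0 q nKq; apply: (du_supp _ cK f0) => Kq; apply: nKq.
by exists (v q, q).
Qed.

Lemma pairing_supp f : (forall p, ~ K p -> f p = 0) ->
  forall q, ~ (@position R d @` K) q -> pairing f q = 0.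
Proof.
move=> f0 q nKq; rewrite /pairing big1// => a _; rewrite big1 ?mulr0// => I _.
by rewrite du_supp_position ?mulr0.
Qed.

(** The counterpart of [fib_ansatzE] for the weak form. Each term is continuous on [D] with support
    in the projection of [K], so the finite sums may be taken inside the integral. *)
Lemma ansatzE f : smooth Om f -> (forall p, ~ K p -> f p = 0) ->
  supp_cont D (@position R d @` K) (pairing f) /\
  ansatz D N v C f = spacetime_integral D (pairing f).
Proof.
move=> sf f0; set K' := _ @` K.
have cK' := compact_position; have KD' := position_sub.
have st (a : 'I_N.+1) (I : a.-tuple 'I_d) :
    supp_cont D K' (fun q => C I q * du I f (v q, q)).
  split=> q Dq; last by move=> nKq; rewrite (du_supp_position _ f0 nKq) mulr0.
  by apply: differentiable_continuous; exact: pairing_term_differentiable.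
have sI (a : 'I_N.+1) := spacetime_integral_bigsum oD cK' KD'
  (index_enum (a.-tuple 'I_d)) (st a).
have [s1 s2] := spacetime_integral_sum oD cK' KD' (index_enum 'I_N.+1)
  (fun a : 'I_N.+1 => a`!%:R^-1) (fun a => (sI a).1).
split; first exact: s1.
rewrite [RHS]s2; apply: eq_bigr => a _; rewrite (sI a).2 -[in RHS]sign_fact -[RHS]mulrA.
congr (_ * _); rewrite big_distrr; apply: eq_bigr => I _.
rewrite /dist_mul foldr_dist_du size_tuple; congr (_ * _).
apply: spacetime_integral_eq => q Dq.
exact: (du_scale_position oOm I (C I) sf (vOm Dq)).
Qed.

(** The projection of [K] is compact in [D], so total derivatives of [pairing f] leave no boundary
    term. *)
Lemma pairing_derive_integral w f : smooth Om f -> (forall p, ~ K p -> f p = 0) ->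
  supp_cont D (@position R d @` K) (fun q => 'D_w (pairing f) q) /\
  spacetime_integral D (fun q => 'D_w (pairing f) q) = 0.
Proof.
move=> sf f0.
apply: (spacetime_integral_derive oD compact_position position_sub).
- by move=> q Dq; exact: pairing_differentiable.
- by move=> q _ nKq; exact: pairing_supp.
- by move=> q Dq; exact: pairing_derive_continuous.
Qed.

Lemma ansatz_weak_solution (f : phase -> R) : smooth Om f ->
  (forall p, ~ K p -> f p = 0) ->
  let g := ansatz D N v C in
  dist_dt g f + dist_div_x G g f + dist_div_u F g f + dist_mul Rc g f = 0.
Proof.
move=> sf f0 g; set K' := @position R d @` K.
have cK' := compact_position; have KD' := position_sub.
have mul0 (h k : phase -> R) : (forall p, ~ K p -> k p = 0) ->
    forall p, ~ K p -> h p * k p = 0.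
  by move=> k0 p nKp; rewrite k0 ?mulr0.
have sGi i := smooth_coord i sG; have sFi i := smooth_coord i sF.
pose ht := pairing (fun p => 'D_((0, dir_t R d) : phase) f p).
pose hx i := pairing (fun p => G p 0 i * 'D_((0, dir_x R i) : phase) f p).
pose hu i := pairing (fun p => F p 0 i * 'D_((e_ R i, 0) : phase) f p).
pose hr := pairing (fun p => Rc p * f p).
have [st It] := ansatzE (smooth_derive ((0, dir_t R d) : phase) sf)
  (derive_supp _ cK f0).
have [sr Ir] := ansatzE (smoothM oOm sRc sf) (mul0 _ _ f0).
have Hx i := ansatzE (smoothM oOm (sGi i) (smooth_derive ((0, dir_x R i) : phase) sf))
  (mul0 _ _ (derive_supp _ cK f0)).
have Hu i := ansatzE (smoothM oOm (sFi i) (smooth_derive ((e_ R i, 0) : phase) sf))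
  (mul0 _ _ (derive_supp _ cK f0)).
have [sdt Idt] := pairing_derive_integral (dir_t R d) sf f0.
have Hdx i := pairing_derive_integral (dir_x R i) (smoothM oOm (sGi i) sf)
  (mul0 _ _ f0).
have [sx Ix] := spacetime_integral_bigsum oD cK' KD' (index_enum 'I_d)
  (fun i => (Hx i).1).
have [su Iu] := spacetime_integral_bigsum oD cK' KD' (index_enum 'I_d)
  (fun i => (Hu i).1).
have [sdx Idx] := spacetime_integral_bigsum oD cK' KD' (index_enum 'I_d)
  (fun i => (Hdx i).1).
have Edt : dist_dt g f = - spacetime_integral D ht by congr (- _).
have Er : dist_mul Rc g f = spacetime_integral D hr by [].
have Ex : dist_div_x G g f = - spacetime_integral D (fun q => \sum_(i < d) hx i q).
  by rewrite Ix -sumrN; apply: eq_bigr => i _; congr (- _); exact: (Hx i).2.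
have Eu : dist_div_u F g f = - spacetime_integral D (fun q => \sum_(i < d) hu i q).
  by rewrite Iu -sumrN; apply: eq_bigr => i _; congr (- _); exact: (Hu i).2.
have Idx0 : spacetime_integral D (fun q => \sum_(i < d)
    'D_(dir_x R i) (pairing (fun p => G p 0 i * f p)) q) = 0.
  by apply: etrans Idx _; apply: big1 => i _; exact: (Hdx i).2.
(* This is [residual f q = 0] solved for the reaction term, each frozen derivative being the total
   derivative minus the part falling on the test function. The explicit coefficients fit
   [spacetime_integralD]; after integration the two total derivatives drop out. *)
have E q : D q -> hr q =
    ht q + 1 * (\sum_(i < d) hx i q) + 1 * (\sum_(i < d) hu i q) +
    (-1) * 'D_(dir_t R d) (pairing f) q +
    (-1) * \sum_(i < d) 'D_(dir_x R i) (pairing (fun p => G p 0 i * f p)) q.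
  move=> Dq.
  have Et : 'D_(dir_t R d) (pairing f) q = ht q + pairing_deriv (dir_t R d) f q.
    exact: pairing_derive.
  have Edx : \sum_(i < d) 'D_(dir_x R i) (pairing (fun p => G p 0 i * f p)) q =
    \sum_(i < d) hx i q +
    \sum_(i < d) (pairing_deriv (dir_x R i) (fun p => G p 0 i * f p) q +
    pairing (fun p => 'D_((0, dir_x R i) : phase) (fun p => G p 0 i) p * f p) q).
    rewrite -big_split; apply: eq_bigr => i _; rewrite [RHS]/=.
    rewrite pairing_derive//; last exact: smoothM.
    rewrite addrCA addrC; congr (_ + _).
    rewrite -[X in _ = _ + X]mul1r -pairing_lin//; last 2 first.
    - by apply: smoothM => //; exact: smooth_derive.
    - by apply: smoothM => //; exact: smooth_derive.
    apply: pairing_ext Dq => p Op; rewrite mul1r.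
    rewrite deriveM;
      [|exact: smooth_derivable (sGi i) Op|exact: smooth_derivable sf Op].
    by congr (_ + _); exact: mulrC.
  have alg (a b x y u r : R) : b + y - u + r = 0 ->
      r = a + 1 * x + 1 * u + -1 * (a + b) + -1 * (x + y).
    move=> byur; have -> : r = - (b + y - u).
      by apply/eqP; rewrite -addr_eq0 addrC byur.
    by ring.
  rewrite Et Edx; apply: alg; exact: residual_eq0.
have lin := spacetime_integralD oD cK' KD'.
have s1 := supp_contD 1 st sx; have s2 := supp_contD 1 s1 su.
have s3 := supp_contD (-1) s2 sdt.
have Eint := spacetime_integral_eq E.
rewrite (lin _ _ _ s3 sdx) (lin _ _ _ s2 sdt) (lin _ _ _ s1 su) (lin _ _ _ st sx)
  in Eint.
have alg (t x u r y z : R) : r = t + 1 * x + 1 * u + -1 * y + -1 * z ->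
  y = 0 -> z = 0 -> - t + - x + - u + r = 0.
  by move=> -> -> ->; ring.
apply: etrans (f_equal2 +%R (f_equal2 +%R (f_equal2 +%R Edt Ex) Eu) Er) _.
exact: alg Eint Idt Idx0.
Qed.

End Pairing.

Theorem theorem2p1 (R : realType) (d : nat) (Omu Omx : set 'rV[R]_d) (T : R)
    (N : nat) (v : spacetime_of R d -> 'rV[R]_d) (C : tensor_fields R d)
    (G F : phase_of R d -> 'rV[R]_d) (Rc : phase_of R d -> R)
    (E : zmodType)
    (A : (phase_of R d -> 'rV[R]_d) -> (phase_of R d -> 'rV[R]_d) ->
         (phase_of R d -> R) -> phase_distr R d -> E) :
  let D := spacetime_dom Omx T in
  let Om := phase_dom Omu Omx T in
  let gN := ansatz D N v C in
  (0 < d)%N -> open Omu -> open Omx -> 0 < T ->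
  smooth_upto D (spacetime_cl Omx T) v ->
  (forall q, spacetime_cl Omx T q -> Omu (v q)) ->
  (forall a : nat, (a <= N)%N ->
     (forall i : a.-tuple 'I_d, smooth D (C a i)) /\ symmetric_on D (C a)) ->
  smooth Om G -> smooth Om F -> smooth Om Rc ->
  A G F Rc gN = 0 ->
  moment_hierarchy D N v C G F Rc ->
  center_equation D v G F ->
  forall phi : phase_of R d -> R, test_function Om phi ->
  dist_dt gN phi + dist_div_x G gN phi + dist_div_u F gN phi
    + dist_mul Rc gN phi = 0.
Proof.
move=> D Om gN _ oOmu oOmx _ [sv _ _] vOmu hC sG sF sRc _ moments center phi.
move=> [sphi [K [cK KOm phi0]]].
have oT : open [set t : R | 0 < t < T].
  rewrite (_ : [set t : R | 0 < t < T] = `]0, T[%classic); last first.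
    by apply/seteqP; split => t /=; rewrite in_itv.
  exact: interval_open.
have oD : open D by exact: openX.
have oOm : open Om by exact: openX.
have vOm q : D q -> Om (v q, q).
  move=> Dq; split; last exact: Dq.
  apply: vOmu; case: Dq => xq /= /andP[t0 tT].
  by split=> //=; rewrite !ltW.
apply: (@ansatz_weak_solution _ _ D Om N v C oD oOm sv vOm _ _ _ G F Rc sG sF
  sRc moments center K cK KOm) => //.
- by move=> p [].
- by move=> a /hC[].
- by move=> a /hC[].
Qed.
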